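(* Let $-1<q<1$ and let $\omega_q$ be the Fock vacuum state on the $q$-deformed $C^*$-algebra $\mathfrak{R}_q$ acting on $\Gamma_q(\ell^2(\mathbb{Z}))$. Then the tail algebra $\xi_{\omega_q}^\perp$, the exchangeable algebra $\pi_{\omega_q}(\mathfrak{R}_q)''_{\mathbb{P}_{\mathbb{Z}}}$ and the stationary algebra $\pi_{\omega_q}(\mathfrak{R}_q)''_{\mathbb{Z}}$ are pairwise different. More precisely, $\xi_{\omega_q}^\perp$ is strictly contained in $\pi_{\omega_q}(\mathfrak{R}_q)''_{\mathbb{P}_{\mathbb{Z}}}$, and the unitary $U_\tau$ belongs to $\pi_{\omega_q}(\mathfrak{R}_q)''_{\mathbb{Z}}$ but not to $\pi_{\omega_q}(\mathfrak{R}_q)''_{\mathbb{P}_{\mathbb{Z}}}$.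
   Context: $q$-deformed Fock space. For $-1<q<1$ and a Hilbert space $\mathcal{H}$, $\Gamma_q(\mathcal{H})$ is the completion of the algebraic linear span of a unit vacuum vector $\zeta_q$ and the vectors $f_1\otimes\cdots\otimes f_n$ ($f_j\in\mathcal{H}$, $n\ge1$) with respect to $$\langle f_1\otimes\cdots\otimes f_m,g_1\otimes\cdots\otimes g_n\rangle_q:=\delta_{n,m}\sum_{\pi\in\mathbb{P}_n}q^{i(\pi)}\langle f_1,g_{\pi(1)}\rangle\cdots\langle f_n,g_{\pi(n)}\rangle,$$ where $\mathbb{P}_n$ is the symmetric group and $i(\pi)$ is the number of inversions of $\pi$. The creator is $l^\dagger(f)\zeta_q=f$, $l^\dagger(f)f_1\otimes\cdots\otimes f_n=f\otimes f_1\otimes\cdots\otimes f_n$, and the annihilator is $l(f)\zeta_q=0$, $l(f)(f_1\otimes\cdots\otimes f_n)=\sum_{k=1}^nq^{k-1}\langle f_k,f\rangle f_1\otimes\cdots\otimes f_{k-1}\otimes f_{k+1}\otimes\cdots\otimes f_n$. They extend to bounded, mutually adjoint operators satisfying $l(f)l^\dagger(g)-ql^\dagger(g)l(f)=\langle g,f\rangle I$. For $\mathcal{H}=\ell^2(\mathbb{Z})$ with canonical orthonormal basis $\{e_j\}_{j\in\mathbb{Z}}$, put $l_j:=l(e_j)$. $\mathfrak{R}_q$ is the unital $C^*$-algebra generated by $\{l_j:j\in\mathbb{Z}\}$ and $\omega_q=\langle\cdot\,\zeta_q,\zeta_q\rangle_q$; its GNS representation $\pi_{\omega_q}$ is (identified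 with) the identity representation on $\Gamma_q(\ell^2(\mathbb{Z}))$. Tail algebra. $\mathfrak{A}$ is the universal unital $C^*$-algebra generated by an element $a$ with $aa^*-qa^*a=1$, and $\iota_j:\mathfrak{A}\to\mathcal{B}(\Gamma_q(\ell^2(\mathbb{Z})))$ is the unital $*$-homomorphism with $\iota_j(a)=l_j$. With $\bigvee$ denoting the von Neumann algebra generated, $$\xi_{\omega_q}^\perp:=\bigcap_{I\subset\mathbb{Z},\ I\text{ finite}}\Big(\bigcup_{K\cap I=\emptyset,\ K\text{ finite}}\Big(\bigvee_{k\in K}\iota_k(\mathfrak{A})\Big)\Big)''.$$ Exchangeable and stationary algebras. $\mathbb{P}_{\mathbb{Z}}$ is the group of permutations of $\mathbb{Z}$ moving only finitely many elements. For $\sigma\in\mathbb{P}_{\mathbb{Z}}$, $U_\sigma$ is the unitary on $\Gamma_q(\ell^2(\mathbb{Z}))$ with $U_\sigma\zeta_q=\zeta_q$, $U_\sigma(e_{i_1}\otimes\cdots\otimes e_{i_k})=e_{\sigma(i_1)}\otimes\cdots\otimes e_{\sigma(i_k)}$; $U_\tau$ is the unitary with $U_\tau\zeta_q=\zeta_q$, $U_\tau(e_{i_1}\otimes\cdots\otimes e_{i_k})=e_{i_1+1}\otimes\cdots\otimes e_{i_k+1}$. Then $\pi_{\omega_q}(\mathfrak{R}_q)''_{\mathbb{P}_{\mathbb{Z}}}:=\{T\in\mathcal{B}(\Gamma_q(\ell^2(\mathbb{Z}))):U_\sigma TU_\sigma^*=T\ \forall\sigma\in\mathbb{P}_{\mathbb{Z}}\}$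 and $\pi_{\omega_q}(\mathfrak{R}_q)''_{\mathbb{Z}}:=\{T\in\mathcal{B}(\Gamma_q(\ell^2(\mathbb{Z}))):U_\tau TU_\tau^*=T\}$. *)

(* Defs.v *)
From HB Require Import structures.
From mathcomp Require Import all_boot all_order all_algebra all_fingroup.
From mathcomp Require Import sesquilinear complex.
From mathcomp Require Import all_classical all_reals all_analysis.
From mathcomp Require Import ring.

Set Implicit Arguments.
Unset Strict Implicit.
Unset Printing Implicit Defensive.
Import Order.TTheory GRing.Theory Num.Theory.
Import numFieldNormedType.Exports.

Local Open Scope classical_set_scope.
Local Open Scope ring_scope.

(* Complex Hilbert spaces; as everywhere below, the inner product is linear in
   its first argument and conjugate-linear in the second. *)
HB.mixin Record isHilbert (R : realType) H & CompleteNormedModule R[i] H := {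
  hdot : {dot H for Num.conj};
  hdot_norm : forall x : H, hdot x x = `|x| ^+ 2 }.

#[short(type="hilbertType")]
HB.structure Definition Hilbert (R : realType) :=
  {H of CompleteNormedModule R[i] H & isHilbert R H}.

Section ZSum.
Variable R : realType.
Implicit Types (x y : int -> R) (F G : int -> R[i]).

(* The sum of x over the integers j with -n <= j < n. *)
Definition zpartial x (n : nat) : R := \sum_(k < n) (x k%:Z + x (Negz k)).

(* Only used on absolutely summable families, for which the order of summation
   is immaterial. *)
Definition zsum F : R[i] :=
  Complex (limn (zpartial (fun j => complex.Re (F j))))
          (limn (zpartial (fun j => complex.Im (F j)))).

Lemma zpartialE x n :
  zpartial x n = \sum_(j <- [seq Posz k | k <- iota 0 n] ++
                             [seq Negz k | k <- iota 0 n]) x j.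
Proof.
rewrite big_cat /= !big_map /zpartial big_split /=.
rewrite -(big_mkord xpredT (fun k => x (Posz k))).
by rewrite -(big_mkord xpredT (fun k => x (Negz k))) /index_iota subn0.
Qed.

Lemma zseq_uniq n : uniq ([seq Posz k | k <- iota 0 n] ++
                          [seq Negz k | k <- iota 0 n]).
Proof.
rewrite cat_uniq !map_inj_uniq ?iota_uniq //=; try by move=> ? ? [].
by rewrite andbT; apply/hasPn => z /mapP[k _ ->]; apply/mapP => -[].
Qed.

Lemma zseq_mem n (j : int) : (`|j| < n)%N ->
  j \in [seq Posz k | k <- iota 0 n] ++ [seq Negz k | k <- iota 0 n].
Proof.
case: j => k; rewrite /= mem_cat => kn; apply/orP.
  by left; apply: map_f; rewrite mem_iota.
by right; apply: map_f; rewrite mem_iota /= add0n ltnW.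
Qed.

Definition abs_summable x :=
  exists M : R, forall s : seq int, uniq s -> \sum_(j <- s) `|x j| <= M.

Lemma zpartial_cvg x : abs_summable x -> cvgn (zpartial x).
Proof.
move=> [M xM].
have -> : zpartial x = series (fun k => x k%:Z + x (Negz k)).
  by apply/funext => n; rewrite /zpartial /series /= big_mkord.
apply: normed_cvg; apply: nondecreasing_is_cvgn.
  by apply: nondecreasing_series => *; exact: normr_ge0.
exists M => _ [n _ <-].
rewrite /normed_series_of /=.
apply: (@le_trans _ _ (zpartial (fun j => `|x j|) n)).
  rewrite /series /= big_mkord; apply: ler_sum => i _; exact: ler_normD.
by rewrite zpartialE; apply: xM; exact: zseq_uniq.
Qed.

Lemma zpartialD x y n :
  zpartial (fun j => x j + y j) n = zpartial x n + zpartial y n.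
Proof. by rewrite /zpartial -big_split; apply: eq_bigr => i _; rewrite addrACA. Qed.

Lemma zpartialZ a x n : zpartial (fun j => a * x j) n = a * zpartial x n.
Proof. by rewrite /zpartial big_distrr /=; apply: eq_bigr => i _; rewrite mulrDr. Qed.

Lemma lim_zpartialD x y : abs_summable x -> abs_summable y ->
  limn (zpartial (fun j => x j + y j)) = limn (zpartial x) + limn (zpartial y).
Proof.
move=> /zpartial_cvg cx /zpartial_cvg cy.
rewrite -limD //; congr (limn _); apply/funext => n; exact: zpartialD.
Qed.

Lemma lim_zpartialZ a x : abs_summable x ->
  limn (zpartial (fun j => a * x j)) = a * limn (zpartial x).
Proof.
move=> /zpartial_cvg cx.
have -> : zpartial (fun j => a * x j) = (fun n => a *: zpartial x n).
  by apply/funext => n; exact: zpartialZ.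
exact: limZr.
Qed.

Lemma abs_summableZ a x : abs_summable x -> abs_summable (fun j => a * x j).
Proof.
move=> [M xM]; exists (`|a| * M) => s us.
under eq_bigr do rewrite normrM.
by rewrite -big_distrr /= ler_wpM2l //; exact: xM.
Qed.

Lemma abs_summableD x y : abs_summable x -> abs_summable y ->
  abs_summable (fun j => x j + y j).
Proof.
move=> [M xM] [N yN]; exists (M + N) => s us.
apply: (le_trans (ler_sum _ (fun j _ => ler_normD (x j) (y j)))).
by rewrite big_split /= lerD ?xM ?yN.
Qed.

Lemma sub_sum_le x (s t : seq int) : (forall j, 0 <= x j) ->
  uniq s -> uniq t -> {subset s <= t} ->
  \sum_(j <- s) x j <= \sum_(j <- t) x j.
Proof.
move=> x0 us ut st.
have p : perm_eq [seq j <- t | j \in s] s.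
  apply: uniq_perm => // [|j]; first exact: filter_uniq.
  by rewrite mem_filter andb_idr // => /st.
rewrite -(perm_big _ p) /= big_filter [leRHS](bigID (mem s)) /= lerDl.
exact: sumr_ge0.
Qed.

Lemma lim_zpartial_ge x (s : seq int) : abs_summable x ->
  (forall j, 0 <= x j) -> uniq s -> \sum_(j <- s) x j <= limn (zpartial x).
Proof.
move=> sx x0 us; apply: limr_ge; first exact: zpartial_cvg.
exists (\max_(j <- s) `|j|%N).+1 => // n /= sn.
rewrite zpartialE; apply: sub_sum_le => // [|j js]; first exact: zseq_uniq.
apply: zseq_mem; apply: leq_trans sn; rewrite ltnS.
exact: leq_bigmax_seq.
Qed.

Lemma lim_zpartial_le x M : abs_summable x ->
  (forall s : seq int, uniq s -> \sum_(j <- s) x j <= M) ->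
  limn (zpartial x) <= M.
Proof.
move=> sx xM; apply: limr_le; first exact: zpartial_cvg.
by exists 0%N => // n _ /=; rewrite zpartialE; apply: xM; exact: zseq_uniq.
Qed.

Definition zsummable F := abs_summable (fun j => complex.Re (F j)) /\
  abs_summable (fun j => complex.Im (F j)).

Lemma zsummableZ c F : zsummable F -> zsummable (fun j => c * F j).
Proof.
case: c => a b [Fr Fi]; split.
  have -> : (fun j => complex.Re (Complex a b * F j)) =
      (fun j => a * complex.Re (F j) + (- b) * complex.Im (F j)).
    by apply/funext => j; case: (F j) => p r /=; rewrite mulNr.
  by apply: abs_summableD; exact: abs_summableZ.
have -> : (fun j => complex.Im (Complex a b * F j)) =
    (fun j => a * complex.Im (F j) + b * complex.Re (F j)).
  by apply/funext => j; case: (F j) => p r /=.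
by apply: abs_summableD; exact: abs_summableZ.
Qed.

Lemma zsumD F G : zsummable F -> zsummable G ->
  zsum (fun j => F j + G j) = zsum F + zsum G.
Proof.
move=> [Fr Fi] [Gr Gi]; rewrite /zsum [RHS]/GRing.add /=.
by congr Complex; rewrite -lim_zpartialD //; congr (limn (zpartial _));
  apply/funext => j; case: (F j) => ? ?; case: (G j).
Qed.

Lemma zsumZ c F : zsummable F -> zsum (fun j => c * F j) = c * zsum F.
Proof.
case: c => a b [Fr Fi]; rewrite /zsum [RHS]/GRing.mul /=.
congr Complex.
  rewrite -mulNr -!lim_zpartialZ // -lim_zpartialD; try exact: abs_summableZ.
  congr (limn (zpartial _)); apply/funext => j.
  by case: (F j) => p r /=; rewrite mulNr.
rewrite -!lim_zpartialZ // -lim_zpartialD; try exact: abs_summableZ.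
by congr (limn (zpartial _)); apply/funext => j; case: (F j).
Qed.

Lemma zsum_conj F : zsummable F -> zsum (fun j => (F j)^*) = (zsum F)^*.
Proof.
move=> [Fr Fi]; rewrite /zsum /=; congr Complex.
  by congr (limn (zpartial _)); apply/funext => j; case: (F j).
rewrite -mulN1r -lim_zpartialZ //.
by congr (limn (zpartial _)); apply/funext => j; case: (F j) => ? ? /=; rewrite mulN1r.
Qed.

End ZSum.

Section DotNorm.
Variables (C : numClosedFieldType) (U : lmodType C).
Variable form : {dot U for Num.conj}.
Local Notation "''[' u , v ]" := (form u v).

Lemma dot_CS u v : `|'[u, v]| ^+ 2 <= '[u, u] * '[v, v].
Proof.
have [->|v0] := eqVneq v 0.
  rewrite linear0r normr0 expr0n /= mulr_ge0 ?dnorm_ge0 //.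
have nv : 0 < '[v, v] by rewrite dnorm_gt0.
pose a := '[u, v] / '[v, v]; pose w := u - a *: v.
have wv : '[w, v] = 0.
  by rewrite linearBl /= linearZl_LR /= divfK ?subrr ?gt_eqF.
have uE : u = w + a *: v by rewrite subrK.
have aE : '[u, v] = a * '[v, v] by rewrite divfK ?gt_eqF.
have wav : '[w, a *: v] = 0. 
  by transitivity (a^* * '[w, v]); [exact: linearZr_LR | rewrite wv mulr0].
have e : '[u, u] = '[w, w] + `|a| ^+ 2 * '[v, v].
  rewrite {1 2}uE; transitivity ('[w, w] + '[a *: v, a *: v]).
    exact: hnormDd.
  by congr (_ + _); exact: dnormZ.
rewrite aE e mulrDl normrM exprMn (ger0_norm (ltW nv)).
have -> : `|a| ^+ 2 * '[v, v] * '[v, v] = `|a| ^+ 2 * '[v, v] ^+ 2 by ring.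
by rewrite lerDr mulr_ge0 ?dnorm_ge0.
Qed.

Lemma dot_normZ a u : sqrtC '[a *: u, a *: u] = `|a| * sqrtC '[u, u].
Proof.
by rewrite dnormZ sqrtCM ?nnegrE ?exprn_ge0 ?dnorm_ge0 // sqrCK.
Qed.

Lemma dot_normD u v :
  sqrtC '[u + v, u + v] <= sqrtC '[u, u] + sqrtC '[v, v].
Proof.
rewrite -(ler_pXn2r (n := 2)) ?nnegrE ?addr_ge0 ?sqrtC_ge0 ?dnorm_ge0 //.
rewrite sqrrD !sqrtCK addrAC dnormD lerD2l.
rewrite -mulr_natr -[_ + _](divfK (negbT (pnatr_eq0 C 2))) -/('Re _) -ReE.
rewrite ler_pM2r ?ltr0n // (le_trans (leif_Re_Creal _).1) //.
rewrite -(ler_pXn2r (n := 2)) ?nnegrE ?mulr_ge0 ?sqrtC_ge0 ?dnorm_ge0 //.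
by rewrite exprMn !sqrtCK dot_CS.
Qed.

End DotNorm.

Section L2.
Variable R : realType.
Local Notation C := R[i].
Implicit Types (f g : int -> C).

Definition sq_summable f :=
  exists M : R, forall s : seq int, uniq s ->
    \sum_(j <- s) `|f j| ^+ 2 <= M%:C%C.

Definition l2_pred : {pred int -> C} := fun f => `[< sq_summable f >].

Lemma sqrD_norm_le (a b : C) : `|a + b| ^+ 2 <= 2 * `|a| ^+ 2 + 2 * `|b| ^+ 2.
Proof.
apply: (@le_trans _ _ ((`|a| + `|b|) ^+ 2)).
  by rewrite ler_pXn2r ?nnegrE ?addr_ge0 ?ler_normD.
rewrite -subr_ge0.
have -> : 2 * `|a| ^+ 2 + 2 * `|b| ^+ 2 - (`|a| + `|b|) ^+ 2 =
  (`|a| - `|b|) ^+ 2 by ring.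
by rewrite real_exprn_even_ge0 ?realB ?normr_real.
Qed.

Lemma sq_summableD f g : sq_summable f -> sq_summable g ->
  sq_summable (f + g).
Proof.
move=> [M fM] [N gN]; exists (2 * M + 2 * N) => s us.
apply: (le_trans (ler_sum _ (fun j _ => sqrD_norm_le (f j) (g j)))).
rewrite big_split -!big_distrr /= rmorphD !rmorphM /= !rmorph_nat.
by rewrite lerD // ler_wpM2l ?ler0n ?fM ?gN.
Qed.

Lemma sq_summableZ c f : sq_summable f -> sq_summable (c *: f).
Proof.
move=> [M fM]; exists (complex.Re (`|c| ^+ 2) * M) => s us.
under eq_bigr do rewrite normrM exprMn.
have e : (complex.Re (`|c| ^+ 2))%:C%C = `|c| ^+ 2.
  by rewrite RRe_real // realX // normr_real.
rewrite -big_distrr /= (rmorphM (real_complex R)) /= e.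
by rewrite ler_wpM2l ?exprn_ge0 ?fM.
Qed.

Lemma sq_summable0 : sq_summable 0.
Proof.
by exists 0 => s _; rewrite big1 // => j _; rewrite normr0 expr0n.
Qed.

Lemma l2_submod_closed : submod_closed l2_pred.
Proof.
split; first exact/asboolP/sq_summable0.
move=> c f g /asboolP fM /asboolP gM; apply/asboolP.
exact/sq_summableD/gM/sq_summableZ.
Qed.

HB.instance Definition _ :=
  GRing.isSubmodClosed.Build C (int -> C) l2_pred l2_submod_closed.

(* The Hilbert space of square-summable families indexed by the integers. *)
Record l2Z := L2Z { l2_fun :> int -> C; l2_funP : l2_fun \in l2_pred }.

HB.instance Definition _ := [isSub for l2_fun].
HB.instance Definition _ := [Choice of l2Z by <:].
HB.instance Definition _ := [SubChoice_isSubZmodule of l2Z by <:].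
HB.instance Definition _ := [SubZmodule_isSubLmodule of l2Z by <:].

Implicit Types u v w : l2Z.

Lemma l2D u v j : (u + v) j = u j + v j. Proof. by []. Qed.
Lemma l2Zs c u j : (c *: u) j = c * u j. Proof. by []. Qed.

Lemma l2P u v : (forall j, u j = v j) -> u = v.
Proof. by move=> uv; apply/val_inj/funext. Qed.

Definition l2dot u v : C := zsum (fun j => u j * (v j)^*).

Lemma ReIm_summable (F : int -> C) (M : R) :
  (forall s : seq int, uniq s -> \sum_(j <- s) `|F j| <= M%:C%C) ->
  zsummable F.
Proof.
move=> FM; split; exists M => s us; rewrite -lecR rmorph_sum /=;
  apply: le_trans (FM _ us); apply: ler_sum => j _.
  exact: normc_ge_Re.
have := normc_ge_Re (F j * 'i%C); rewrite ReiNIm normrN normrM.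
by rewrite [`|'i%C|]normc_def /= expr0n expr1n add0r sqrtr1 mulr1.
Qed.

Lemma l2dot_summable u v : zsummable (fun j => u j * (v j)^*).
Proof.
have /asboolP[M uM] := l2_funP u; have /asboolP[N vN] := l2_funP v.
apply: (@ReIm_summable _ (M + N)) => s us.
rewrite rmorphD /=; apply: le_trans (lerD (uM _ us) (vN _ us)).
rewrite -big_split /=; apply: ler_sum => j _.
rewrite normrM norm_conjC -subr_ge0.
have -> : `|u j| ^+ 2 + `|v j| ^+ 2 - `|u j| * `|v j| =
   2^-1 * (`|u j| - `|v j|) ^+ 2 + 2^-1 * (`|u j| ^+ 2 + `|v j| ^+ 2) by field.
have sq0 : 0 <= (`|u j| - `|v j|) ^+ 2.
  by rewrite real_exprn_even_ge0 ?realB ?normr_real.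
have sq1 : 0 <= `|u j| ^+ 2 + `|v j| ^+ 2 by rewrite addr_ge0 ?exprn_ge0.
have h0 : 0 <= 2^-1 :> C by rewrite invr_ge0 ler0n.
exact: addr_ge0 (mulr_ge0 h0 sq0) (mulr_ge0 h0 sq1).
Qed.

Lemma l2dot_linear v c u w : l2dot (c *: u + w) v = c * l2dot u v + l2dot w v.
Proof.
have su := l2dot_summable u v; have sw := l2dot_summable w v.
rewrite /l2dot -zsumZ // -zsumD //; last exact: zsummableZ.
by congr zsum; apply/funext => j; rewrite l2D l2Zs mulrDl mulrA.
Qed.

Lemma l2dotC u v : l2dot u v = (l2dot v u)^*.
Proof.
rewrite /l2dot -zsum_conj; last exact: l2dot_summable.
by congr zsum; apply/funext => j; rewrite rmorphM /= conjCK mulrC.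
Qed.

Lemma l2dot_bilinear :
  bilinear_for (GRing.Scale.Law.clone _ _ *%R _)
    (GRing.Scale.Law.clone _ _ (Num.conj \; *%R) _) l2dot.
Proof.
split=> [v c u w|u c v w] /=; first exact: l2dot_linear.
by rewrite !(l2dotC u) l2dot_linear rmorphD rmorphM.
Qed.

Lemma l2dotuuE u : l2dot u u =
  (limn (zpartial (fun j => complex.Re (`|u j| ^+ 2))))%:C%C.
Proof.
rewrite /l2dot /zsum; congr Complex.
  by congr (limn (zpartial _)); apply/funext => j; rewrite normCK.
have -> : (fun j => complex.Im (u j * (u j)^*)) = cst 0.
  by apply/funext => j; rewrite -normCK ger0_Im ?exprn_ge0.
have -> : zpartial (cst 0) = cst (0 : R).
  by apply/funext => n; rewrite /zpartial big1 //= => k _; rewrite addr0.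
exact: lim_cst.
Qed.

Lemma sumsqE (s : seq int) u : \sum_(j <- s) `|u j| ^+ 2 =
  (\sum_(j <- s) complex.Re (`|u j| ^+ 2))%:C%C.
Proof.
rewrite (rmorph_sum (real_complex R)); apply: eq_bigr => j _.
by apply: esym; apply: RRe_real; rewrite realX // normr_real.
Qed.

Lemma l2_sq_summable u : abs_summable (fun j => complex.Re (`|u j| ^+ 2)).
Proof.
have [h _] := l2dot_summable u u.
by under eq_fun do rewrite normCK.
Qed.

Lemma l2norm_ge (s : seq int) u : uniq s ->
  \sum_(j <- s) `|u j| ^+ 2 <= l2dot u u.
Proof.
move=> us; rewrite sumsqE l2dotuuE lecR; apply: lim_zpartial_ge => //.
  exact: l2_sq_summable.
by move=> j; have := exprn_ge0 2 (normr_ge0 (u j)); rewrite lecE => /andP[].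
Qed.

Lemma l2norm_le u (M : R) :
  (forall s : seq int, uniq s -> \sum_(j <- s) `|u j| ^+ 2 <= M%:C%C) ->
  l2dot u u <= M%:C%C.
Proof.
move=> uM; rewrite l2dotuuE lecR; apply: lim_zpartial_le.
  exact: l2_sq_summable.
by move=> s us; rewrite -lecR -sumsqE; exact: uM.
Qed.

Lemma l2dot_gt0 u : u != 0 -> 0 < l2dot u u.
Proof.
move=> u0; have [j uj] : exists j, u j != 0.
  apply: contrapT => /forallNP u0'; move/eqP: u0; apply; apply: l2P => j.
  by apply/eqP/negP => /negP; exact: u0'.
apply: lt_le_trans (@l2norm_ge [:: j] u isT).
by rewrite big_seq1 exprn_gt0 // normr_gt0.
Qed.

Lemma l2dot_herm u v : l2dot u v = (-1) ^+ false * (l2dot v u)^*.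
Proof. by rewrite mul1r -l2dotC. Qed.

HB.instance Definition _ := bilinear_isBilinear.Build C l2Z l2Z C _ _ l2dot
  l2dot_bilinear.
HB.instance Definition _ :=
  isHermitianSesquilinear.Build C l2Z false Num.conj l2dot l2dot_herm.
HB.instance Definition _ := isDotProduct.Build C l2Z l2dot l2dot_gt0.

Let form : {dot l2Z for Num.conj} := l2dot.

Definition l2norm u : C := sqrtC (l2dot u u).

Lemma l2normD u v : l2norm (u + v) <= l2norm u + l2norm v.
Proof. exact: dot_normD form u v. Qed.

Lemma l2normZ c u : l2norm (c *: u) = `|c| * l2norm u.
Proof. exact: dot_normZ form c u. Qed.

Lemma l2norm0_eq0 u : l2norm u = 0 -> u = 0.
Proof. by move/eqP; rewrite sqrtC_eq0 (dnorm_eq0 form) => /eqP. Qed.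

HB.instance Definition _ :=
  Lmodule_isNormed.Build C l2Z l2normD l2normZ l2norm0_eq0.

Lemma l2_norm2 u : `|u| ^+ 2 = l2dot u u.
Proof. exact: sqrtCK. Qed.

Lemma l2coord_le u j : `|u j| <= `|u|.
Proof.
rewrite -(ler_pXn2r (n := 2)) ?nnegrE ?normr_ge0 // l2_norm2.
by have := @l2norm_ge [:: j] u isT; rewrite big_seq1.
Qed.

Let rcoord (i : bool) (z : C) : R := if i then complex.Re z else complex.Im z.

Let rcoordB i z z' : rcoord i (z - z') = rcoord i z - rcoord i z'.
Proof. by case: i z z' => -[? ?] [? ?]. Qed.

Let rcoord_le i z : `|rcoord i z|%:C%C <= `|z|.
Proof.
case: i; first exact: normc_ge_Re.
have := normc_ge_Re (z * 'i%C); rewrite ReiNIm normrN normrM.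
by rewrite [`|'i%C|]normc_def /= expr0n expr1n add0r sqrtr1 mulr1.
Qed.

Let sqE z : `|z| ^+ 2 = (rcoord true z ^+ 2 + rcoord false z ^+ 2)%:C%C.
Proof. by rewrite add_Re2_Im2. Qed.

Lemma l2_complete (F : set_system l2Z) : ProperFilter F -> cauchy F -> cvg F.
Proof.
move=> FF /cauchyP Fc.
pose gl i j := lim ((fun u : l2Z => rcoord i (u j)) @ F).
have cg i j : (fun u : l2Z => rcoord i (u j)) @ F --> gl i j.
  apply: cauchy_cvg; apply: cauchy_exP => e e0.
  have [|x Fx] := Fc e%:C%C; first by rewrite ltcR.
  exists (rcoord i (x j)).
  apply: (@filterS _ F _ (ball x e%:C%C)) Fx => u; rewrite -!ball_normE /= => xu.
  rewrite -rcoordB -ltcR; apply: le_lt_trans xu.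
  exact: le_trans (rcoord_le i _) (l2coord_le (x - u) j).
pose g j : C := Complex (gl true j) (gl false j).
have gE i j : rcoord i (g j) = gl i j by case: i.
have key (e : R) x (s : seq int) : F (ball x e%:C%C) -> uniq s ->
    \sum_(j <- s) `|x j - g j| ^+ 2 <= (e ^+ 2)%:C%C.
  move=> Fx us.
  pose Phi (u : int -> C) : R := \sum_(j <- s)
    (rcoord true (x j - u j) ^+ 2 + rcoord false (x j - u j) ^+ 2).
  have PhiE (u : int -> C) : \sum_(j <- s) `|x j - u j| ^+ 2 = (Phi u)%:C%C.
    rewrite (rmorph_sum (real_complex R)); apply: eq_bigr => j _; exact: sqE.
  rewrite PhiE lecR.
  have cPhi : (fun u : l2Z => Phi u) @ F --> Phi g.
    apply: cvg_big => [|j _]; first exact: add_continuous.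
    have c i : (fun u : l2Z => rcoord i (x j - u j)) @ F --> rcoord i (x j - g j).
      rewrite rcoordB gE; under eq_fun do rewrite rcoordB.
      by apply: cvgB; [exact: cvg_cst | exact: cg].
    by apply: cvgD; under eq_fun do rewrite expr2; rewrite expr2; apply: cvgM.
  apply: (cvgr_to_le cPhi); apply: filterS Fx => u; rewrite -ball_normE /= => xu.
  rewrite -lecR -PhiE.
  apply: le_trans (l2norm_ge (x - u) us) _.
  rewrite -l2_norm2 rmorphXn /= ler_pXn2r ?nnegrE ?normr_ge0 ?(ltW xu) //.
  exact: le_trans (normr_ge0 _) (ltW xu).
have [|x1 Fx1] := Fc 1; first exact: ltr01.
have gP : g \in l2_pred.
  have -> : g = (x1 : int -> C) - ((x1 : int -> C) - g) by rewrite subKr.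
  apply: rpredB; first exact: l2_funP.
  by apply/asboolP; exists (1 ^+ 2) => s us; exact: (key 1).
pose G := L2Z gP.
apply/cvg_ex; exists G; apply/cvg_ballP => eps eps0.
have epsE : eps = (complex.Re eps)%:C%C by rewrite RRe_real // gtr0_real.
have e0 : 0 < complex.Re eps by rewrite -ltcR -epsE.
pose e := complex.Re eps / 2.
have e20 : 0 < e by rewrite divr_gt0.
have [|x Fx] := Fc e%:C%C; first by rewrite ltcR.
have xG : `|x - G| <= e%:C%C.
  rewrite -(ler_pXn2r (n := 2)) ?nnegrE ?normr_ge0 ?lecR ?(ltW e20) //.
  rewrite l2_norm2 -rmorphXn /=; apply: l2norm_le => s us; exact: key.
apply: filterS Fx => u; rewrite -!ball_normE /= => xu.
rewrite -(subrK x G) -addrA; apply: le_lt_trans (ler_normD _ _) _.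
have -> : eps = e%:C%C + e%:C%C by rewrite -rmorphD /= -splitr.
by rewrite -normrN opprB ler_ltD.
Qed.

HB.instance Definition _ := Uniform_isComplete.Build l2Z l2_complete.

Lemma l2dot_norm u : form u u = `|u| ^+ 2. Proof. by rewrite l2_norm2. Qed.

HB.instance Definition _ := isHilbert.Build R l2Z l2dot_norm.

Lemma delta_bound (i : int) (s : seq int) : uniq s ->
  \sum_(j <- s) `|(j == i)%:R : C| ^+ 2 <= 1%:C%C.
Proof.
move=> us; under eq_bigr do rewrite normr_nat -natrX; rewrite -natr_sum.
have -> : (\sum_(j <- s) (j == i) ^ 2 = (i \in s))%N.
  rewrite -(count_uniq_mem _ us) -sum1_count [RHS]big_mkcond /=.
  by apply: eq_bigr => j _; case: (j == i).
by case: (i \in s).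
Qed.

Lemma delta_l2 (i : int) : (fun j => (j == i)%:R) \in l2_pred.
Proof. by apply/asboolP; exists 1 => s; exact: delta_bound. Qed.

Definition l2e (i : int) : l2Z := L2Z (delta_l2 i).

Lemma l2e_orthonormal i k : hdot (l2e i) (l2e k) = (i == k)%:R.
Proof.
have [<-|ik] := eqVneq i k; last first.
  rewrite [LHS]/(l2dot _ _) /l2dot.
  have -> : (fun j => l2e i j * (l2e k j)^*) = cst 0.
    apply/funext => j /=; have [->|_] := eqVneq j i; last by rewrite mul0r.
    by rewrite (negPf ik) conjC0 mulr0.
  have z0 : zpartial (cst 0) = cst (0 : R).
    by apply/funext => n; rewrite /zpartial big1 //= => m _; rewrite addr0.
  by rewrite /zsum /= z0 lim_cst.
apply/le_anti/andP; split.
  rewrite -[leRHS]/(1%:C%C); apply: l2norm_le => s us.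
  exact: delta_bound.
have := @l2norm_ge [:: i] (l2e i) isT.
by rewrite big_seq1 /= eqxx normr1 expr1n.
Qed.

End L2.

Section Operators.
Variables (R : realType) (H : hilbertType R).
Implicit Types (T U V : H -> H) (M : set (H -> H)).

(* B(H) *)
Definition bop : set (H -> H) := [set T | linear T /\ continuous T].

Definition is_adjoint T V := forall x y, hdot (T x) y = hdot x (V y).

(* For T in B(H) the adjoint exists, by the Riesz theorem, and is unique. *)
Definition adj T : H -> H := xget (fun=> 0) [set V | is_adjoint T V].

Definition unitary U := [/\ linear U, range U = setT &
  forall x y, hdot (U x) (U y) = hdot x y].

Definition commutant M : set (H -> H) :=
  [set T | bop T /\ forall V, M V -> T \o V = V \o T].

Definition bicommutant M := commutant (commutant M).

Definition adjoints M : set (H -> H) :=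
  [set V | exists2 T, M T & is_adjoint T V].

(* The von Neumann algebra generated by M. *)
Definition vngen M := bicommutant (M `|` adjoints M).

Definition conj_fixed U : set (H -> H) :=
  [set T | bop T /\ U \o T \o adj U = T].

Definition lspan (S : set H) : set H :=
  [set x | exists n (c : 'I_n -> R[i]) (v : 'I_n -> H),
    (forall i, S (v i)) /\ x = \sum_(i < n) c i *: v i].

End Operators.

Section Fock.
Variable R : realType.
Implicit Types (q : R) (H : hilbertType R).

Definition inversions n (p : 'S_n) : nat :=
  #|[pred ij : 'I_n * 'I_n | (ij.1 < ij.2)%N && (p ij.2 < p ij.1)%N]|.

(* The q-inner product of s_1 (x) ... (x) s_n and t_1 (x) ... (x) t_m; the
   empty sequence stands for the vacuum vector. *)
Definition qform q H (s t : seq H) : R[i] :=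
  if size s == size t then
    \sum_(p : 'S_(size s)) (q ^+ inversions p)%:C%C *
      \prod_(i < size s) hdot (nth 0 s i) (nth 0 t (p i))
  else 0.

(* A completion of the algebraic span of the vacuum and of the elementary
   tensors for the q-inner product: a Hilbert space containing the elementary
   tensors, with the prescribed inner products and a dense span.  Multilinearity
   of fock_tensor is automatic, because qform is multilinear and the inner
   product of fock_space is definite. Any two completions are isomorphic by a
   unitary that matches the elementary tensors. *)
Record qFock q H := QFock {
  fock_space :> hilbertType R;
  fock_tensor : seq H -> fock_space;
  fock_dot : forall s t, hdot (fock_tensor s) (fock_tensor t) = qform q s t;
  fock_dense : dense (lspan (range fock_tensor)) }.

Definition vacuum q H (G : qFock q H) : G := fock_tensor G [::].

(* L is the annihilator l(f). The vacuum is the case s = [::], and the index k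
   starts at 0 here, whence q ^+ k in place of q^(k-1). *)
Definition annihilator q H (G : qFock q H) (f : H) (L : G -> G) :=
  bop L /\ forall s : seq H, L (fock_tensor G s) =
    \sum_(k < size s) ((q ^+ k)%:C%C * hdot (nth 0 s k) f) *:
      fock_tensor G (take k s ++ drop k.+1 s).

(* U is the unitary induced on the Fock space by the map s of the index set. *)
Definition index_unitary q (G : qFock q (l2Z R)) (s : int -> int) (U : G -> G) :=
  [/\ unitary U, U (vacuum G) = vacuum G &
    forall w : seq int, U (fock_tensor G [seq l2e R i | i <- w]) =
                        fock_tensor G [seq l2e R (s i) | i <- w]].

End Fock.

(* Permutations of the integers moving only finitely many of them. *)
Definition finperm (s : int -> int) :=
  bijective s /\ finite_set [set i | s i <> i].

(* Unital C*-algebras. The norm takes values in R[i], like the norm of any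
   normed module over R[i]. *)
HB.mixin Record isCstar (R : realType) A & GRing.Algebra R[i] A := {
  star : A -> A;
  starK : involutive star;
  starD : {morph star : x y / x + y};
  starZ : forall (c : R[i]) x, star (c *: x) = c^* *: star x;
  starM : forall x y, star (x * y) = star y * star x;
  cnorm : A -> R[i];
  cnormD : forall x y, cnorm (x + y) <= cnorm x + cnorm y;
  cnormZ : forall (c : R[i]) x, cnorm (c *: x) = `|c| * cnorm x;
  cnorm0_eq0 : forall x, cnorm x = 0 -> x = 0;
  cnormM : forall x y, cnorm (x * y) <= cnorm x * cnorm y;
  cnorm_star : forall x, cnorm (star x * x) = cnorm x ^+ 2;
  cnorm_complete : forall u : nat -> A,
    (forall e, 0 < e -> exists N, forall m n,
       (N <= m)%N -> (N <= n)%N -> cnorm (u m - u n) < e) ->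
    exists x, forall e, 0 < e -> exists N, forall n,
       (N <= n)%N -> cnorm (u n - x) < e }.

#[short(type="cstarType")]
HB.structure Definition Cstar (R : realType) :=
  {A of GRing.Algebra R[i] A & isCstar R A}.

Section Universal.
Variables (R : realType) (q : R).

Definition qrelation (A : cstarType R) (a : A) :=
  a * star a - q%:C%C *: (star a * a) = 1.

Record cstar_subalg (A : cstarType R) (S : set A) : Prop := {
  subalg1 : S 1;
  subalgL : forall c x y, S x -> S y -> S (c *: x + y);
  subalgM : forall x y, S x -> S y -> S (x * y);
  subalg_star : forall x, S x -> S (star x);
  subalg_closed : forall x,
    (forall e, 0 < e -> exists2 y, S y & cnorm (x - y) < e) -> S x }.

(* A is the universal unital C*-algebra generated by an element a subject to
   a a^* - q a^* a = 1. *)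
Definition universal_qalg (A : cstarType R) (a : A) :=
  [/\ qrelation a,
      forall S : set A, cstar_subalg S -> S a -> S = setT &
      forall (B : cstarType R) (b : B), qrelation b ->
        exists phi : {lrmorphism A -> B},
          (forall x, phi (star x) = star (phi x)) /\ phi a = b].

(* Unital *-homomorphisms into B(H). *)
Record star_hom (A : cstarType R) (H : hilbertType R) (rho : A -> H -> H) :
    Prop := {
  star_hom_bop : forall x, bop (rho x);
  star_hom_linear : forall c x y v,
    rho (c *: x + y) v = c *: rho x v + rho y v;
  star_hom1 : rho 1 = id;
  star_homM : forall x y, rho (x * y) = rho x \o rho y;
  star_hom_star : forall x, is_adjoint (rho x) (rho (star x)) }.

End Universal.

Section Algebras.
Variables (R : realType) (q : R) (G : qFock q (l2Z R)).

Definition tail_algebra (A : cstarType R) (iota : int -> A -> G -> G) :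
    set (G -> G) :=
  \bigcap_(I in [set I : set int | finite_set I])
    bicommutant (\bigcup_(K in [set K : set int | finite_set K /\
                                                  K `&` I = set0])
      vngen (\bigcup_(k in K) range (iota k))).

(* Of U, only the unitaries U s with s a finite permutation matter. *)
Definition exchangeable_algebra (U : (int -> int) -> G -> G) : set (G -> G) :=
  [set T | bop T /\ forall s, finperm s -> conj_fixed (U s) T].

Definition stationary_algebra (Utau : G -> G) : set (G -> G) :=
  conj_fixed Utau.

End Algebras.

(* Main.v *)
Require Import Defs.
From mathcomp Require Import all_boot all_order all_algebra all_fingroup.
From mathcomp Require Import zify.
From mathcomp Require Import sesquilinear complex.
From mathcomp Require Import all_classical all_reals all_analysis.
Import Order.TTheory GRing.Theory Num.Theory.
Import numFieldNormedType.Exports.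
Set Implicit Arguments.
Unset Strict Implicit.
Unset Printing Implicit Defensive.
Local Open Scope classical_set_scope.
Local Open Scope ring_scope.

(** Write l_k for the annihilator of the basis vector e_k, l_k^* for its adjoint
   and t(s) for the elementary tensor of the sequence s, so that
   l_k^* t(s) = t(e_k :: s) by [creator_tensor].

   The tail algebra lies in the exchangeable one because a finite permutation
   unitary U_s commutes with l_k and l_k^* as soon as s fixes k. It then commutes
   with the whole of iota_k(A): the elements x for which it commutes with
   iota_k(x) and iota_k(x^* ) form a norm-closed unital *-subalgebra containing
   the generator ([commute_generated]). So U_s lies in the commutant of
   everything generated by the iota_k(A) with k outside the support of s, and
   each tail operator commutes with it ([tail_comm]). Closedness rests on
   *-homomorphisms being contractive: if x has norm less than 1, then
   1 - x^* x = b^2 for a self-adjoint b, so that |v|^2 - |iota_k(x) v|^2 is the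
   square of the norm of iota_k(b) v ([selfadjoint_sqrt],
   [star_hom_contraction]). As U_s is only known on tensors of basis vectors,
   these have to be shown to be total ([basis_tensors_sep]).

   The inclusion is strict because the projection P onto the vacuum commutes with
   each U_s but is not a tail operator. Let J be the unitary reversing the
   order of the factors of a tensor, which exists because reversing both
   arguments does not change the q-inner product ([qform_rev],
   [contraction_extension], [reversal_exists]). The operator r = J l_0 J
   annihilates on the right instead of on the left; for k different from 0 it
   commutes with l_k and l_k^* ([reversed_annihilator_comm]), hence with every
   tail operator. But r P t(e_0) = 0, whereas P r t(e_0) is the vacuum.

   The shift unitary commutes with itself, but not with the unitary of the
   transposition of 0 and 1, as evaluation at t(e_0) shows. This separates the
   stationary algebra from the exchangeable one, and from the tail algebra
   inside it. *)

(** * Bounded operators on a Hilbert space *)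

Section Hilbert.
Variables (R : realType) (H : hilbertType R).
Implicit Types (T U V : H -> H) (x y z : H).

Lemma hdotDl z : {morph (fun x : H => hdot x z) : x y / x + y}.
Proof. exact: linearDl. Qed.

Lemma hdotDr z : {morph hdot z : x y / x + y}.
Proof. exact: linearDr. Qed.

Lemma hdotBl z : {morph (fun x : H => hdot x z) : x y / x - y}.
Proof. exact: linearBl. Qed.

Lemma hdotBr z : {morph hdot z : x y / x - y}.
Proof. exact: linearBr. Qed.

Lemma hdotZl c x z : hdot (c *: x) z = c * hdot x z.
Proof. exact: linearZl_LR. Qed.

Lemma hdotZr c x z : hdot x (c *: z) = c^* * hdot x z.
Proof. exact: linearZr_LR. Qed.

Lemma hdot_suml I (s : seq I) (F : I -> H) z :
  hdot (\sum_(i <- s) F i) z = \sum_(i <- s) hdot (F i) z.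
Proof. exact: linear_sumlz. Qed.

Lemma hdot_sumr I (s : seq I) (F : I -> H) z :
  hdot z (\sum_(i <- s) F i) = \sum_(i <- s) hdot z (F i).
Proof. exact: linear_sumr. Qed.

Lemma hdotC x y : hdot x y = (hdot y x)^*.
Proof. by have := hermC hdot x y; rewrite expr0 mul1r. Qed.

Lemma hdot_inj x y : (forall z, hdot x z = hdot y z) -> x = y.
Proof.
move=> xy; apply/eqP; rewrite -subr_eq0 -normr_eq0 -sqrf_eq0 -hdot_norm.
by rewrite hdotBl xy subrr.
Qed.

Lemma adjoint_sym T V : is_adjoint T V -> is_adjoint V T.
Proof. by move=> TV x y; rewrite hdotC -TV -hdotC. Qed.

Lemma adjoint_uniq T V W : is_adjoint T V -> is_adjoint T W -> V = W.
Proof.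
move=> /adjoint_sym TV /adjoint_sym TW; apply/funext => x.
by apply: hdot_inj => z; rewrite TV TW.
Qed.

(** Lets a commutation relation be checked on the adjoints, which may be given by
   simpler formulas. *)
Lemma adjoint_comm T T' V V' : is_adjoint T T' -> is_adjoint V V' ->
  T' \o V' = V' \o T' -> T \o V = V \o T.
Proof.
move=> TT' VV' e; apply/funext => x; apply: hdot_inj => z /=.
by rewrite TT' VV' VV' TT' -[V' (T' z)]/((V' \o T') z) -e.
Qed.

(** [adj] is defined by choice; uniqueness identifies it with any adjoint at
   hand. *)
Lemma adjE T V : is_adjoint T V -> adj T = V.
Proof.
move=> TV; rewrite /adj; case: xgetP => [W _ TW|/(_ V)//].
exact: adjoint_uniq TW TV.
Qed.

Lemma lipschitz_bop T (M : R[i]) :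
  linear T -> (forall x, `|T x| <= M * `|x|) -> bop T.
Proof.
move=> lT TM; split=> // x; apply/cvgrPdist_lt => e e0.
have TB y : T x - T y = T (x - y).
  by rewrite -[- y]scaleN1r [x + _]addrC lT scaleN1r addrC.
have M0 : 0 < `|M| + 1 by rewrite ltr_wpDl.
near=> y; rewrite TB; apply: le_lt_trans (TM _) _.
have [->|xy] := eqVneq (x - y) 0; first by rewrite normr0 mulr0.
have Mr : M \is Num.real.
  have := le_trans (normr_ge0 _) (TM (x - y)).
  by rewrite pmulr_lge0 ?normr_gt0 // => /ger0_real.
apply: (@le_lt_trans _ _ ((`|M| + 1) * `|x - y|)).
  by rewrite ler_wpM2r // (le_trans (real_ler_norm Mr)) // lerDl.
rewrite mulrC -ltr_pdivlMr //; near: y.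
by apply/nbhs_normP; exists (e / (`|M| + 1)) => //=; exact: divr_gt0.
Unshelve. all: by end_near. Qed.

Lemma bopB T x y : bop T -> T (x - y) = T x - T y.
Proof. by move=> [lT _]; rewrite -[- y]scaleN1r [x + _]addrC lT scaleN1r addrC. Qed.

Lemma bop0 T : bop T -> T 0 = 0.
Proof. by move=> bT; have := bopB 0 0 bT; rewrite !subrr. Qed.

Lemma bopZ T c x : bop T -> T (c *: x) = c *: T x.
Proof. by move=> bT; case: (bT) => lT _; rewrite -[c *: x]addr0 lT bop0 // addr0. Qed.

Lemma bopD T x y : bop T -> T (x + y) = T x + T y.
Proof. by move=> [lT _]; rewrite -[x]scale1r lT !scale1r. Qed.

Lemma bop_sum T I (s : seq I) (F : I -> H) :
  bop T -> T (\sum_(i <- s) F i) = \sum_(i <- s) T (F i).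
Proof.
move=> bT; elim: s => [|i s IH]; first by rewrite !big_nil bop0.
by rewrite !big_cons bopD // IH.
Qed.

Lemma bop_comp T V : bop T -> bop V -> bop (T \o V).
Proof.
move=> [lT cT] [lV cV]; split=> [c x y|x] /=; first by rewrite lV lT.
by apply: continuous_comp; [exact: cV|exact: cT].
Qed.

Lemma unitary_bop U : unitary U -> bop U.
Proof.
move=> [lU _ iU]; apply: (@lipschitz_bop _ 1) => // x.
rewrite mul1r -(ler_pXn2r (n := 2)) ?nnegrE ?normr_ge0 //.
by rewrite -!hdot_norm iU.
Qed.

Lemma unitary_adj U : unitary U -> cancel U (adj U) /\ cancel (adj U) U.
Proof.
move=> uU; case: (uU) => lU sU iU.
have /choice[V UV] : forall y, exists x, U x = y.
  by move=> y; have [x _ <-] : range U y by [rewrite sU]; exists x.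
have aV : is_adjoint U V by move=> x y; rewrite -{1}(UV y) iU.
rewrite (adjE aV); split=> // x; apply: hdot_inj => z.
by rewrite -iU UV iU.
Qed.

Lemma unitary_is_adjoint U : unitary U -> is_adjoint U (adj U).
Proof.
move=> uU x y; have [_ KU] := unitary_adj uU; have [_ _ iU] := uU.
by rewrite -{1}(KU y) iU.
Qed.

Lemma conj_fixedE U T : unitary U ->
  conj_fixed U T <-> bop T /\ U \o T = T \o U.
Proof.
move=> /unitary_adj[UK KU]; split=> -[bT e]; split=> //.
  by rewrite -{2}e; apply/funext => x /=; rewrite UK.
by rewrite e; apply/funext => x /=; rewrite KU.
Qed.

Lemma dense_bop_eq (S : set H) T V : dense (lspan S) -> bop T -> bop V ->
  (forall x, S x -> T x = V x) -> T = V.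
Proof.
move=> dS bT bV TV; apply/funext => x; apply/eqP; rewrite -subr_eq0.
apply/negPn/negP => D0.
pose F y := T y - V y.
have cF : continuous F.
  move=> y; apply: continuousB; [exact: (proj2 bT)|exact: (proj2 bV)].
have : ~` (F @^-1` [set 0]) `&` lspan S !=set0.
  apply: dS; first by exists x; apply/eqP.
  apply: closed_openC; apply: closed_comp => [y _|]; first exact: cF.
  exact/accessible_closed_set1/hausdorff_accessible/norm_hausdorff.
case=> y [Fy [n [c [v [Sv yE]]]]]; apply: Fy.
rewrite /= /F yE (bop_sum _ _ bT) (bop_sum _ _ bV) -sumrB big1 // => i _.
by rewrite (bopZ _ _ bT) (bopZ _ _ bV) TV // subrr.
Qed.

End Hilbert.

(** * Extension of contractions from a dense span *)

Section Extension.
Variables (R : realType) (H : hilbertType R) (I : Type).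
Implicit Types (t : I -> H) (p : seq (R[i] * I)) (x y : H).

(** Linear combinations are kept formal, as lists of coefficients and indices: an
   element of the span does not determine its coefficients, and an extension
   problem has to relate two evaluations of the same coefficients. *)
Definition lincomb t p : H := \sum_(a <- p) a.1 *: t a.2.

Definition scalep (c : R[i]) p := [seq (c * a.1, a.2) | a <- p].

Lemma lincomb_cat t p r : lincomb t (p ++ r) = lincomb t p + lincomb t r.
Proof. exact: big_cat. Qed.

Lemma lincombZ t c p : lincomb t (scalep c p) = c *: lincomb t p.
Proof.
rewrite /lincomb big_map scaler_sumr; apply: eq_bigr => a _ /=.
by rewrite scalerA.
Qed.

Lemma lincombB t p r :
  lincomb t (p ++ scalep (-1) r) = lincomb t p - lincomb t r.
Proof. by rewrite lincomb_cat lincombZ scaleN1r. Qed.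

Lemma lincomb_dense t : dense (lspan (range t)) ->
  forall x (e : R[i]), 0 < e -> exists p, `|x - lincomb t p| < e.
Proof.
move=> dt x e e0.
have [] := dt (ball x e); first by exists x; exact: ballxx.
  exact: ball_open.
move=> y [xy [n [c [v [tv yE]]]]].
have /choice[k kv] : forall i, exists j, t j = v i.
  by move=> i; have [j _ <-] := tv i; exists j.
exists [seq (c i, k i) | i <- enum 'I_n].
move: xy; rewrite -ball_normE /= yE /lincomb big_map big_enum /=.
by under [in X in _ -> X]eq_bigr do rewrite kv.
Qed.

(** Combinations of the t i that approximate x are sent to a Cauchy filter, whose
   limit J x satisfies |J x - t'(p)| <= |x - t(p)| for each formal combination
   p. This one estimate determines J and yields in turn its values on the span,
   its linearity and its continuity. *)
Theorem contraction_extension t t' : dense (lspan (range t)) ->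
  (forall p, `|lincomb t' p| <= `|lincomb t p|) ->
  exists J : H -> H, bop J /\ forall i, J (t i) = t' i.
Proof.
move=> dt tt'.
have dist p r : `|lincomb t' p - lincomb t' r| <= `|lincomb t p - lincomb t r|.
  by rewrite -!lincombB.
have /choice[J JP] : forall x, exists y,
    forall r, `|y - lincomb t' r| <= `|x - lincomb t r|.
  move=> x.
  pose near_x (e : R[i]) := [set p | `|x - lincomb t p| < e].
  pose F := filter_from [set e : R[i] | 0 < e] near_x.
  have FF : ProperFilter F.
    apply: filter_from_proper => [|e e0]; last exact: lincomb_dense.
    apply: filter_from_filter; first by exists 1; exact: ltr01.
    move=> e e' /= e0 e'0.
    have /orP[ee'|e'e] := real_leVge (gtr0_real e0) (gtr0_real e'0).
      by exists e => // p pe; split=> //; exact: lt_le_trans ee'.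
    by exists e' => // p pe; split=> //; exact: lt_le_trans e'e.
  have Fc : cvg (lincomb t' @ F).
    apply: cauchy_cvg; apply: cauchy_exP => e e0.
    have e20 : 0 < e / 2 by rewrite divr_gt0.
    have [p xp] := lincomb_dense dt x e20.
    exists (lincomb t' p); exists (e / 2) => // r xr.
    rewrite -ball_normE /=; apply: le_lt_trans (dist _ _) _.
    rewrite -(subrK x (lincomb t p)) -addrA.
    apply: le_lt_trans (ler_normD _ _) _.
    by rewrite [e]splitr ltrD // distrC.
  have [y Fy] := (cvg_ex _).1 Fc.
  exists y => r; apply/ler_addgt0Pr => e e0.
  have e20 : 0 < e / 2 by rewrite divr_gt0.
  have [p [xp yp]] : exists p, `|x - lincomb t p| < e / 2 /\
                              `|y - lincomb t' p| < e / 2.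
    have FA : F (near_x (e / 2)) by exists (e / 2).
    have FB : F [set p | `|y - lincomb t' p| < e / 2].
      by have /(_ _ _ _ Fy _ e20) := @cvgr_dist_lt _ H _ F _.
    by have [p [? ?]] := filter_ex (filterI FA FB); exists p.
  rewrite -(subrK (lincomb t' p) y) -addrA.
  apply: le_trans (ler_normD _ _) _.
  apply: le_trans (lerD (ltW yp) (dist _ _)) _.
  rewrite -(subrK x (lincomb t p)) -addrA.
  apply: le_trans (lerD (lexx _) (ler_normD _ _)) _.
  rewrite [in leRHS](splitr e) addrA addrC lerD2l.
  by rewrite lerD2l ltW // distrC.
have JE p : J (lincomb t p) = lincomb t' p.
  apply/eqP; rewrite -subr_eq0 -normr_le0.
  by apply: le_trans (JP _ p) _; rewrite subrr normr0.
exists J; split; last first.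
  by move=> i; have := JE [:: (1, i)]; rewrite /lincomb !big_seq1 !scale1r.
apply: (@lipschitz_bop _ _ _ 1) => [c x y|x]; last first.
  by have := JP x [::]; rewrite /lincomb !big_nil !subr0 mul1r.
apply/eqP; rewrite -subr_eq0 -normr_le0; apply/ler_addgt0Pr => e e0; rewrite add0r.
pose d := e / (2 * (`|c| + 1)).
have c10 : 0 < `|c| + 1 by rewrite ltr_wpDl.
have d0 : 0 < d by rewrite divr_gt0 // mulr_gt0.
have dE : e / 2 = `|c| * d + d.
  rewrite -[X in _ + X]mul1r -mulrDl /d invfM mulrCA; congr (_ * _).
  by rewrite mulrCA mulfV ?mulr1 // gt_eqF.
have [p xp] := lincomb_dense dt x d0; have [r yr] := lincomb_dense dt y d0.
pose s := scalep c p ++ r.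
have sE u : lincomb u s = c *: lincomb u p + lincomb u r.
  by rewrite lincomb_cat lincombZ.
have split_norm (a b a' b' : H) :
    `|c *: a + b - (c *: a' + b')| <= `|c| * `|a - a'| + `|b - b'|.
  by rewrite opprD addrACA -scalerBr (le_trans (ler_normD _ _)) // normrZ.
have xy_le : `|c *: x + y - lincomb t s| <= e / 2.
  rewrite sE dE; apply: le_trans (split_norm _ _ _ _) _.
  by rewrite lerD ?ler_wpM2l // ltW.
rewrite -(subrK (lincomb t' s) (J _)) -addrA [e]splitr.
apply: le_trans (ler_normD _ _) (lerD _ _); first exact: le_trans (JP _ _) xy_le.
rewrite distrC sE dE; apply: le_trans (split_norm _ _ _ _) _.
by rewrite lerD ?ler_wpM2l // (le_trans (JP _ _)) // ltW.
Qed.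

End Extension.

(** * Permutations and the q-inner product *)

Section Inversions.

Lemma inversionsE n (p : 'S_n) :
  inversions p = (\sum_(i < n) \sum_(j < n) ((i < j) && (p j < p i)))%N.
Proof.
rewrite pair_bigA /= /inversions -sum1_card big_mkcond.
by apply: eq_bigr => -[i j] _ /=; rewrite inE /=; case: andP.
Qed.

Lemma ltn_bump2 h i j : (bump h i < bump h j)%N = (i < j)%N.
Proof. by rewrite !ltnNge leq_bump2. Qed.

(** In the permutation that sends j to 0 and acts as p elsewhere, the inversions
   involving j are the pairs (a, j) with a < j, and there are j of them. *)
Lemma inversions_lift n (j : 'I_n.+1) (p : 'S_n) :
  inversions (lift_perm j ord0 p) = (j + inversions p)%N.
Proof.
rewrite !inversionsE (bigD1_ord j) //= lift_perm_id big1 ?add0n; last first.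
  by move=> b _; rewrite andbF.
under eq_bigr => a _.
  rewrite (bigD1_ord j) //= lift_perm_id lift_perm_lift /= andbT.
  under eq_bigr => b _ do rewrite lift_perm_lift /= !ltn_bump2.
  over.
rewrite big_split /=; congr (_ + _)%N.
under eq_bigr => a _.
  have -> : (bump j a < j)%N = (a < j)%N.
    by rewrite /bump; case: (leqP j a) => ja /=; lia.
  over.
have jn : (j <= n)%N by rewrite -ltnS.
transitivity (\sum_(a < n | (a < j)%N) 1)%N.
  by rewrite [RHS]big_mkcond; apply: eq_bigr => i _; case: ltnP.
by rewrite (big_ord_narrow jn) sum_nat_const card_ord muln1.
Qed.

(** Conjugation by the reversal r flips both the order of the positions and the
   order of the values, so that (i, j) is an inversion of p if and only if
   (r j, r i) is one of r p r. *)
Lemma inversions_rev n (p r : 'S_n) : (forall i, r i = rev_ord i) ->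
  inversions (r * p * r)%g = inversions p.
Proof.
have rev_lt (i j : 'I_n) : (rev_ord i < rev_ord j)%N = (j < i)%N.
  by rewrite /= ltn_sub2lE.
move=> rE; rewrite !inversionsE exchange_big /=.
rewrite (reindex_inj rev_ord_inj) /=; apply: eq_bigr => i _.
rewrite (reindex_inj rev_ord_inj) /=; apply: eq_bigr => j _.
by rewrite !permM !rE !rev_ordK !rev_lt.
Qed.

(** A permutation is determined by the position of 0 and by what remains when that
   position is removed; comparing the cardinals n.+1 * n! and (n.+1)! spares
   the construction of the inverse map. *)
Lemma sum_perm_lift (V : nmodType) n (F : 'S_n.+1 -> V) :
  \sum_p F p = \sum_(j < n.+1) \sum_(p : 'S_n) F (lift_perm j ord0 p).
Proof.
rewrite pair_bigA /=.
apply: (reindex (fun jp : 'I_n.+1 * 'S_n => lift_perm jp.1 ord0 jp.2)).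
apply: onW_bij; apply: inj_card_bij.
  move=> [j p] [k s] /= e.
  have jk : j = k.
    apply: (perm_inj (s := lift_perm j ord0 p)).
    by rewrite {2}e !lift_perm_id.
  subst k; congr (_, _); apply/permP => i; apply: (@lift_inj _ ord0).
  by rewrite -!(lift_perm_lift j) e.
by rewrite card_prod !card_Sn card_ord factS.
Qed.

End Inversions.

Section QForm.
Variables (R : realType) (q : R) (H : hilbertType R).
Implicit Types (s u : seq H) (f : H).

Lemma qformE n s u : size s = n -> size u = n ->
  qform q s u = \sum_(p : 'S_n) (q ^+ inversions p)%:C%C *
    \prod_(i < n) hdot (nth 0 s i) (nth 0 u (p i)).
Proof. by move=> <- us; rewrite /qform us eqxx. Qed.

Lemma qform_size s u : size s != size u -> qform q s u = 0.
Proof. by rewrite /qform => /negPf ->. Qed.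

Definition without s k := take k s ++ drop k.+1 s.

Lemma size_without s k : (k < size s)%N -> size (without s k) = (size s).-1.
Proof.
move=> ks; rewrite size_cat size_take size_drop ks subnS.
by rewrite -subn1 addnBA ?subn_gt0 // subnKC 1?ltnW // subn1.
Qed.

Lemma nth_without s k i : (k < size s)%N ->
  nth 0 (without s k) i = nth 0 s (bump k i).
Proof.
move=> ks; rewrite nth_cat size_take ks /bump.
case: ltnP => ik; first by rewrite nth_take // leqNgt ik.
by rewrite nth_drop addSn subnKC.
Qed.

(** Expansion along the first factor on the right: classify the permutations by the
   index k that is matched with f. This is the adjointness of creators and
   annihilators in terms of the q-inner product. *)
Lemma qform_consr s f u : qform q s (f :: u) =
  \sum_(k < size s) ((q ^+ k)%:C%C * hdot (nth 0 s k) f) *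
    qform q (without s k) u.
Proof.
have [su|su] := eqVneq (size s) (size u).+1; last first.
  rewrite qform_size // big1 // => k _; rewrite qform_size ?mulr0 //.
  by rewrite size_without // -eqSS prednK // (leq_trans _ (ltn_ord k)).
rewrite (qformE (n := (size u).+1)) // sum_perm_lift su; apply: eq_bigr => j _.
have js : (j < size s)%N by rewrite su.
rewrite (qformE (n := size u)) ?size_without ?su // big_distrr /=.
apply: eq_bigr => p _.
rewrite inversions_lift exprD (rmorphM (real_complex R)) /= (bigD1_ord j) //=.
rewrite lift_perm_id /= mulrACA; congr (_ * (_ * _)).
by apply: eq_bigr => i _; rewrite lift_perm_lift nth_without.
Qed.

(** This is what makes the reversal of tensors isometric. *)
Lemma qform_rev s u : qform q (rev s) (rev u) = qform q s u.
Proof.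
have [us|su] := eqVneq (size u) (size s); last first.
  by rewrite !qform_size ?size_rev // eq_sym.
pose r : 'S_(size s) := perm (@rev_ord_inj (size s)).
have rE i : r i = rev_ord i by rewrite permE.
rewrite !(qformE (n := size s)) ?size_rev //.
rewrite (reindex_inj (mulIg r)) (reindex_inj (mulgI r)) /=.
apply: eq_bigr => p _; rewrite inversions_rev //; congr (_ * _).
rewrite (reindex_inj rev_ord_inj); apply: eq_bigr => i _.
rewrite !permM !rE rev_ordK !nth_rev ?us ?ltn_ord //.
by rewrite -?[(_ - _)%N]/(val (rev_ord (rev_ord _))) !rev_ordK.
Qed.

End QForm.

(** * Operators on the Fock space determined by elementary tensors *)

Section RankOne.
Variables (R : realType) (H : hilbertType R).
Implicit Types (x y z w : H) (T : H -> H).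

Lemma hdot_CS x y : `|hdot x y| <= `|x| * `|y|.
Proof.
rewrite -(ler_pXn2r (n := 2)) ?nnegrE ?mulr_ge0 //.
by rewrite exprMn -!hdot_norm; exact: dot_CS.
Qed.

Definition rank_one z w x : H := hdot x z *: w.

Lemma rank_one_bop z w : bop (rank_one z w).
Proof.
apply: (@lipschitz_bop _ _ _ (`|z| * `|w|)) => [c x y|x].
  by rewrite /rank_one hdotDl hdotZl scalerDl scalerA.
by rewrite normrZ mulrAC ler_wpM2r // mulrC hdot_CS.
Qed.

(** An equality of bounded linear functionals becomes one of bounded operators, to
   which [dense_bop_eq] applies, after multiplication by a fixed vector; the
   vector x itself will do. *)
Lemma dense_hdot_eq (S : set H) T y z : dense (lspan S) -> bop T ->
  (forall x, S x -> hdot (T x) y = hdot x z) ->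
  forall x, hdot (T x) y = hdot x z.
Proof.
move=> dS bT Tyz x.
have [->|x0] := eqVneq x 0; first by rewrite (bop0 bT) !linear0l.
have e : rank_one y x \o T = rank_one z x.
  apply: (dense_bop_eq dS); [|exact: rank_one_bop|].
    by apply: bop_comp => //; exact: rank_one_bop.
  by move=> v Sv; rewrite /rank_one /= Tyz.
have /eqP := congr1 (@^~ x) e.
rewrite /rank_one /= -subr_eq0 -scalerBl scaler_eq0 (negPf x0) orbF subr_eq0.
by move/eqP.
Qed.

Lemma id_bop : bop (@id H).
Proof. by apply: (@lipschitz_bop _ _ _ 1) => // x; rewrite mul1r. Qed.

End RankOne.

Section Fock.
Variables (R : realType) (q : R) (H : hilbertType R) (G : qFock q H).
Local Notation t := (fock_tensor G).
Implicit Types (s u : seq H) (f g : H) (x y : G) (L C : G -> G).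

Lemma tensor_bop_eq L C : bop L -> bop C ->
  (forall s, L (t s) = C (t s)) -> L = C.
Proof.
move=> bL bC LC; apply: (dense_bop_eq (@fock_dense _ _ _ G)) => // _ [s _ <-].
exact: LC.
Qed.

Lemma tensor_sep x y : (forall s, hdot (t s) x = hdot (t s) y) -> x = y.
Proof.
move=> xy; apply: hdot_inj => z; rewrite hdotC [RHS]hdotC; congr (_ ^*).
apply: (dense_hdot_eq (@fock_dense _ _ _ G) (@id_bop _ _)) => _ [s _ <-].
exact: xy.
Qed.

Lemma tensor_adjoint L C : bop L -> bop C ->
  (forall s u, hdot (L (t s)) (t u) = hdot (t s) (C (t u))) -> is_adjoint L C.
Proof.
move=> bL bC LC x y; rewrite hdotC [RHS]hdotC; congr (_ ^*); apply: esym.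
apply: (dense_hdot_eq (@fock_dense _ _ _ G) bC) => _ [u _ <-].
rewrite hdotC [RHS]hdotC; congr (_ ^*); apply: esym.
by apply: (dense_hdot_eq (@fock_dense _ _ _ G) bL) => _ [s _ <-].
Qed.

Lemma lincomb_norm (I : Type) (v : I -> G) p :
  `|lincomb v p| ^+ 2 =
  \sum_(a <- p) \sum_(b <- p) a.1 * (b.1^* * hdot (v a.2) (v b.2)).
Proof.
rewrite -hdot_norm /lincomb hdot_suml; apply: eq_bigr => a _.
by rewrite hdot_sumr; apply: eq_bigr => b _; rewrite hdotZl hdotZr.
Qed.

(** By [qform_rev], reversing the tensors of a linear combination does not change
   its norm. *)
Lemma reversal_exists : exists J : G -> G, bop J /\ forall s, J (t s) = t (rev s).
Proof.
apply: contraction_extension; first exact: fock_dense.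
move=> p; rewrite -(ler_pXn2r (n := 2)) ?nnegrE ?normr_ge0 //.
rewrite !lincomb_norm le_eqVlt; apply/orP; left; apply/eqP.
apply: eq_bigr => a _; apply: eq_bigr => b _.
by rewrite !fock_dot qform_rev.
Qed.

Lemma reversal_selfadjoint (J : G -> G) : bop J ->
  (forall s, J (t s) = t (rev s)) -> is_adjoint J J.
Proof.
move=> bJ JE; apply: tensor_adjoint => // s u.
by rewrite !JE !fock_dot -{1}(revK u) qform_rev.
Qed.

Lemma creator_tensor f L L' : annihilator f L -> is_adjoint L L' ->
  forall s, L' (t s) = t (f :: s).
Proof.
move=> [bL LE] LL' s; apply: tensor_sep => u.
rewrite -LL' LE fock_dot qform_consr hdot_suml; apply: eq_bigr => k _.
by rewrite hdotZl fock_dot.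
Qed.

(** Multilinearity of the tensors in their first factor is read off the expansion
   of their inner products, which determine them. *)
Lemma tensor_cons_linear c f g s :
  t ((c *: f + g) :: s) = c *: t (f :: s) + t (g :: s).
Proof.
apply: tensor_sep => u; rewrite hdotDr hdotZr !fock_dot !qform_consr.
rewrite big_distrr -big_split /=; apply: eq_bigr => k _.
rewrite hdotDr hdotZr; set z := qform _ _ _; set w := _%:C%C.
by rewrite mulrDr mulrDl; congr (_ + _); rewrite mulrCA !mulrA.
Qed.

(** As |q| <= 1, each of the n! terms of the q-inner product is at most the product
   of the squared norms, by the Cauchy-Schwarz inequality. *)
Lemma tensor_norm_le s : `|q| <= 1 ->
  `|t s| ^+ 2 <= (size s)`!%:R * \prod_(i < size s) `|nth 0 s i| ^+ 2.
Proof.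
move=> q1; rewrite -hdot_norm fock_dot (qformE q (n := size s)) //.
rewrite -[leLHS]ger0_norm; last first.
  by have := dnorm_ge0 hdot (t s); rewrite fock_dot (qformE q (n := size s)).
apply: le_trans (ler_norm_sum _ _ _) _.
rewrite -card_Sn mulr_natl -sumr_const.
rewrite [leRHS](eq_bigl xpredT) => [|p]; last by rewrite inE.
apply: ler_sum => p _; rewrite normrM.
rewrite -[leRHS]mul1r ler_pM //.
  rewrite normc_def /= expr0n /= addr0 sqrtr_sqr -[1]/(1%:C%C) lecR normrX.
  by rewrite exprn_ile1.
rewrite normr_prod.
apply: (@le_trans _ _ (\prod_(i < size s) (`|nth 0 s i| * `|nth 0 s (p i)|))).
  by apply: ler_prod => i _; rewrite normr_ge0 hdot_CS.
rewrite big_split /=.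
have <- : \prod_(i < size s) `|nth 0 s i| = \prod_(i < size s) `|nth 0 s (p i)|.
  by rewrite (reindex_inj (@perm_inj _ p)).
by rewrite -big_split.
Qed.

End Fock.

(** * Annihilation on the right *)

Section RightAnnihilator.
Variables (R : realType) (q : R) (H : hilbertType R) (G : qFock q H).
Local Notation t := (fock_tensor G).
Implicit Types (s v : seq H) (f g : H) (L C J : G -> G).

Lemma annihilator_rcons f g L v : annihilator f L -> hdot g f = 0 ->
  L (t (rcons v g)) = \sum_(k < size v) ((q ^+ k)%:C%C * hdot (nth 0 v k) f) *:
                        t (rcons (without v k) g).
Proof.
move=> [_ ->] gf.
rewrite -(big_mkord xpredT (fun k => ((q ^+ k)%:C%C *
  hdot (nth 0 (rcons v g) k) f) *: t (without (rcons v g) k))).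
rewrite size_rcons big_nat_recr //= nth_rcons ltnn eqxx gf mulr0 scale0r addr0.
rewrite big_mkord; apply: eq_bigr => k _.
have kv := ltn_ord k; rewrite nth_rcons kv /without -!cats1.
rewrite (takel_cat _ (ltnW kv)) -catA; congr (_ *: t (_ ++ _)).
rewrite drop_cat; case: ltnP => // vk.
have -> : k.+1 = size v by apply/eqP; rewrite eqn_leq kv.
by rewrite drop_size subnn drop0.
Qed.

(** The operator J Lf J removes factors starting from the right end, while Lg' adds
   a factor g on the left end; they could only interfere by pairing g with f, and
   these are orthogonal. Commutation with Lg is seen on the adjoints, which add
   factors at opposite ends. *)
Lemma reversed_annihilator_comm f g Lf Lf' Lg Lg' J :
  annihilator f Lf -> is_adjoint Lf Lf' -> bop Lf' ->
  annihilator g Lg -> is_adjoint Lg Lg' -> bop Lg' -> hdot g f = 0 ->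
  bop J -> (forall s, J (t s) = t (rev s)) ->
  (J \o Lf \o J) \o Lg = Lg \o (J \o Lf \o J) /\
  (J \o Lf \o J) \o Lg' = Lg' \o (J \o Lf \o J).
Proof.
move=> aLf ff' bLf' aLg gg' bLg' gf bJ JE.
have JJ := reversal_selfadjoint bJ JE.
have f'E := creator_tensor aLf ff'; have g'E := creator_tensor aLg gg'.
have bLf : bop Lf by case: aLf.
have bC : bop (J \o Lf \o J) by do 2! [apply: bop_comp => //].
have bC' : bop (J \o Lf' \o J) by do 2! [apply: bop_comp => //].
split.
  apply: (adjoint_comm (T' := J \o Lf' \o J) _ gg').
    by move=> x y /=; rewrite JJ ff' JJ.
  apply: tensor_bop_eq; [exact: bop_comp|exact: bop_comp|move=> s /=].
  by rewrite !(JE, f'E, g'E) !rev_cons rev_rcons -rcons_cons.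
apply: tensor_bop_eq; [exact: bop_comp|exact: bop_comp|move=> s /=].
(* The factor g is now at the end, where it contributes no term. *)
rewrite g'E !JE rev_cons (annihilator_rcons _ aLf gf) (proj2 aLf).
rewrite !bop_sum //; apply: eq_bigr => k _.
by rewrite !bopZ // !JE rev_rcons g'E.
Qed.

End RightAnnihilator.

(** * Totality of the tensors of basis vectors *)

Section BasisTensors.
Variables (R : realType).
Local Notation C := R[i].
Implicit Types (f g : l2Z R).

Lemma l2_sumE f (s : seq int) i : uniq s ->
  (\sum_(j <- s) f j *: l2e R j : l2Z R) i = (i \in s)%:R * f i.
Proof.
elim: s => [|j s IH] /= => [_|/andP[js us]]; first by rewrite big_nil mul0r.
rewrite big_cons l2D l2Zs IH // inE /=.
have [->|ij] := eqVneq i j; last by rewrite mulr0 add0r.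
by rewrite (negPf js) mulr1 mul0r addr0 mul1r.
Qed.

Lemma l2_approx f (e : R) : 0 < e -> exists s : seq int,
  `|f - \sum_(j <- s) f j *: l2e R j| ^+ 2 <= e%:C%C.
Proof.
move=> e0; pose x j := complex.Re (`|f j| ^+ 2).
have cx := zpartial_cvg (l2_sq_summable f).
pose L := limn (zpartial x).
have [n nL] : exists n, `|L - zpartial x n| < e.
  have cL : \forall n \near \oo, `|L - zpartial x n| < e.
    by have /(_ _ _ _ cx _ e0) := @cvgr_dist_lt _ R^o _ \oo _.
  by have [n nL] := filter_ex cL; exists n.
exists ([seq Posz k | k <- iota 0 n] ++ [seq Negz k | k <- iota 0 n]).
have := zseq_uniq n; have := zpartialE x n; set s := _ ++ _ => zE us.
have gE i : (f - \sum_(j <- s) f j *: l2e R j : l2Z R) i = (i \notin s)%:R * f i.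
  rewrite -[LHS]/(f i - (\sum_(j <- s) f j *: l2e R j : l2Z R) i) l2_sumE //.
  by case: (i \in s); rewrite ?mul1r ?mul0r ?subrr ?subr0.
move: (f - _ : l2Z R) gE => g gE.
rewrite l2_norm2; apply: l2norm_le => s' us'.
have -> : \sum_(j <- s') `|g j| ^+ 2 =
    \sum_(j <- [seq j <- s' | j \notin s]) `|f j| ^+ 2.
  rewrite big_filter [RHS]big_mkcond /=; apply: eq_bigr => j _.
  by rewrite gE; case: (j \in s); rewrite ?mul1r // mul0r normr0 expr0n.
have : \sum_(j <- [seq j <- s' | j \notin s] ++ s) `|f j| ^+ 2 <= L%:C%C.
  rewrite -l2dotuuE; apply: l2norm_ge.
  rewrite cat_uniq us filter_uniq // andbT.
  by apply/hasPn => j js; rewrite mem_filter js.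
rewrite big_cat /= [X in _ + X]sumsqE -zE -lerBrDr => /le_trans; apply.
by rewrite -rmorphB lecR (le_trans (ler_norm _)) // ltW.
Qed.

(** A bounded functional vanishing on the canonical basis vanishes, by
   approximation with finite combinations. *)
Lemma l2_functional0 (phi : l2Z R -> C) (M : R) :
  (forall c f g, phi (c *: f + g) = c * phi f + phi g) ->
  (forall f, `|phi f| ^+ 2 <= M%:C%C * `|f| ^+ 2) ->
  (forall j, phi (l2e R j) = 0) -> forall f, phi f = 0.
Proof.
move=> lphi bphi phi0 f.
have phiB g h : phi (h - g) = phi h - phi g.
  by rewrite addrC -scaleN1r lphi mulN1r addrC.
have phi_sum (s : seq int) : phi (\sum_(j <- s) f j *: l2e R j) = 0.
  elim: s => [|j s IH].
    by rewrite big_nil -(subrr (0 : l2Z R)) phiB subrr.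
  by rewrite big_cons lphi phi0 IH mulr0 addr0.
apply/eqP; rewrite -normr_eq0 -sqrf_eq0 eq_le exprn_ge0 // andbT.
apply/ler_addgt0Pr => e e0; rewrite add0r.
have eE : e = (complex.Re e)%:C%C by rewrite RRe_real // gtr0_real.
have re0 : 0 < complex.Re e by rewrite -ltcR -eE.
have M10 : 0 < `|M| + 1 by rewrite ltr_wpDl.
have [s fs] := l2_approx f (divr_gt0 re0 M10).
have -> : phi f = phi (f - \sum_(j <- s) f j *: l2e R j).
  by rewrite phiB phi_sum subr0.
apply: le_trans (bphi _) _.
have MM : M%:C%C <= (`|M| + 1)%:C%C.
  by rewrite lecR (le_trans (ler_norm _)) // lerDl.
apply: le_trans (ler_wpM2r (exprn_ge0 _ (normr_ge0 _)) MM) _.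
apply: le_trans (ler_wpM2l _ fs) _; first by rewrite -[0]/(0%:C%C) lecR ltW.
by rewrite -rmorphM /= mulrCA mulfV ?mulr1 -?eE // gt_eqF.
Qed.

Variables (q : R) (hq : -1 < q < 1) (G : qFock q (l2Z R)).
Local Notation t := (fock_tensor G).

(** The vectors x orthogonal to all tensors of basis vectors form a set invariant
   under the annihilators L j, since the creators L' j map those tensors to one
   another. By induction on s, such an x is orthogonal to t(s): if s = f :: s',
   then the inner product of t(f :: s') and x is a bounded linear functional of
   f, whose value at e_j is the inner product of t(s') and L j x. *)
Lemma basis_tensors_sep (L L' : int -> G -> G) :
  (forall j, annihilator (l2e R j) (L j)) ->
  (forall j, is_adjoint (L j) (L' j)) ->
  forall x : G,
  (forall w : seq int, hdot (t [seq l2e R i | i <- w]) x = 0) -> x = 0.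
Proof.
move=> aL LL' x xw; apply: (@tensor_sep _ _ _ G) => s; rewrite linear0r.
elim: s x xw => [|f s IH] x xw; first exact: (xw [::]).
have q1 : `|q| <= 1 by rewrite ler_norml !ltW //; case/andP: hq.
(* The bound of that functional is the estimate of [tensor_norm_le]. *)
pose M : C := (size s).+1`!%:R * \prod_(i < size s) `|nth 0 s i| ^+ 2 * `|x| ^+ 2.
have MR : (complex.Re M)%:C%C = M.
  apply: RRe_real; apply: ger0_real.
  by rewrite !mulr_ge0 ?exprn_ge0 ?prodr_ge0.
apply: (@l2_functional0 (fun f => hdot (t (f :: s)) x) (complex.Re M)) => //.
- by move=> c g h; rewrite tensor_cons_linear hdotDl hdotZl.
- move=> g; rewrite MR; apply: (@le_trans _ _ (`|t (g :: s)| ^+ 2 * `|x| ^+ 2)).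
    by rewrite -exprMn ler_pXn2r ?nnegrE ?mulr_ge0 // hdot_CS.
  rewrite /M [leRHS]mulrAC ler_wpM2r ?exprn_ge0 //.
  apply: le_trans (tensor_norm_le _ _ q1) _ => /=.
  by rewrite big_ord_recl /= mulrCA mulrC.
move=> j; rewrite -(creator_tensor (aL j) (LL' j)) (adjoint_sym (LL' j)).
apply: IH => w; rewrite -(adjoint_sym (LL' j)) (creator_tensor (aL j) (LL' j)).
exact: (xw (j :: w)).
Qed.

End BasisTensors.

(** * Contractivity of star-homomorphisms *)

Section CstarNorm.
Variables (R : realType) (A : cstarType R).
Local Notation C := R[i].
Implicit Types (x y z : A).

Lemma cnormN x : cnorm (- x) = cnorm x.
Proof. by rewrite -scaleN1r cnormZ normrN1 mul1r. Qed.

Lemma cnorm0 : cnorm (0 : A) = 0.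
Proof. by rewrite -(scale0r (0 : A)) cnormZ normr0 mul0r. Qed.

Lemma cnorm_ge0 x : 0 <= cnorm x.
Proof.
have := cnormD x (- x); rewrite subrr cnorm0 cnormN -mulr2n.
by rewrite pmulrn_lge0.
Qed.

Lemma cdistC x y : cnorm (x - y) = cnorm (y - x).
Proof. by rewrite -cnormN opprB. Qed.

Lemma cnorm_eq_small x : (forall e : C, 0 < e -> cnorm x <= e) -> x = 0.
Proof.
move=> small; apply: cnorm0_eq0; apply/eqP; rewrite eq_le cnorm_ge0 andbT.
by apply/ler_addgt0Pr => e e0; rewrite add0r small.
Qed.

Lemma star0 : star (0 : A) = 0.
Proof. by rewrite -(scale0r (0 : A)) starZ rmorph0 !scale0r. Qed.

Lemma starN x : star (- x) = - star x.
Proof. by rewrite -scaleN1r starZ rmorphN1 scaleN1r. Qed.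

Lemma star1 : star (1 : A) = 1.
Proof.
by rewrite -[RHS](starK (1 : A)) -{2}[star 1]mulr1 starM starK mulr1.
Qed.

Lemma star_contract x : cnorm (star x) <= cnorm x.
Proof.
have [->|x0] := eqVneq (cnorm (star x)) 0; first exact: cnorm_ge0.
have p0 : 0 < cnorm (star x) by rewrite lt_def x0 cnorm_ge0.
rewrite -(ler_pM2r p0) -expr2 -cnorm_star starK.
exact: cnormM.
Qed.

Lemma sqrB_le x y : cnorm (x * x - y * y) <= (cnorm x + cnorm y) * cnorm (x - y).
Proof.
have -> : x * x - y * y = x * (x - y) + (x - y) * y.
  by rewrite mulrBr mulrBl addrA subrK.
apply: le_trans (cnormD _ _) _; rewrite [leRHS]mulrDl.
by rewrite lerD ?cnormM // [leRHS]mulrC cnormM.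
Qed.

Section SquareRoot.
Variables (y : A) (r : R).
Hypotheses (r0 : 0 <= r) (r1 : r < 1) (yr : cnorm y <= r%:C%C) (ys : star y = y).

(** If z = (y + z^2) / 2, then (1 - z)^2 = 1 - y. Iterating this fixed-point equation
   from 0 remains in the ball of radius r < 1, where the map is a contraction of
   ratio r. *)
Fixpoint sqrt_iter n : A :=
  if n is m.+1 then 2^-1 *: (y + sqrt_iter m * sqrt_iter m) else 0.

Let rC0 : 0 <= r%:C%C :> C. Proof. by rewrite -[0]/(0%:C%C) lecR. Qed.
Let h0 : 0 <= 2^-1 :> C. Proof. by rewrite invr_ge0 ler0n. Qed.
Let two_half (c : C) : 2^-1 * (c + c) = c.
Proof. by rewrite -mulr2n -[c *+ 2]mulr_natl mulrA mulVf ?mul1r // pnatr_eq0. Qed.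

Lemma sqrt_iter_le n : cnorm (sqrt_iter n) <= r%:C%C.
Proof.
elim: n => [|n IH] /=; first by rewrite cnorm0.
rewrite cnormZ ger0_norm // -[leRHS]two_half ler_wpM2l //.
apply: le_trans (cnormD _ _) _; rewrite lerD // (le_trans (cnormM _ _)) //.
apply: (@le_trans _ _ (r%:C%C * r%:C%C)); first by rewrite ler_pM ?cnorm_ge0.
by rewrite -rmorphM lecR ler_piMl // ltW.
Qed.

Lemma sqrt_iter_star n : star (sqrt_iter n) = sqrt_iter n.
Proof.
elim: n => [|n IH] /=; first exact: star0.
by rewrite starZ starD starM ys IH; congr (_ *: _); rewrite conj_Creal // ger0_real.
Qed.

(** Shifting both indices by one multiplies the distance by at most r, and the case
   n = 0 is the bound on the iterates. *)
Lemma sqrt_iter_cauchy n k :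
  cnorm (sqrt_iter (n + k) - sqrt_iter n) <= (r ^+ n.+1)%:C%C.
Proof.
elim: n => [|n IH]; first by rewrite add0n subr0 expr1 sqrt_iter_le.
rewrite addSn /= -scalerBr cnormZ ger0_norm // opprD addrACA subrr add0r.
apply: (@le_trans _ _ (2^-1 * ((r%:C%C + r%:C%C) * (r ^+ n.+1)%:C%C))).
  rewrite ler_wpM2l // (le_trans (sqrB_le _ _)) //.
  by rewrite ler_pM ?addr_ge0 ?cnorm_ge0 // lerD // sqrt_iter_le.
by rewrite mulrA two_half -rmorphM -exprS.
Qed.

Lemma selfadjoint_sqrt : exists b, star b = b /\ b * b = 1 - y.
Proof.
have small (e : C) : 0 < e -> exists N, forall n, (N <= n)%N -> (r ^+ n.+1)%:C%C < e.
  move=> e0; have eE : e = (complex.Re e)%:C%C by rewrite RRe_real // gtr0_real.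
  have re0 : 0 < complex.Re e by rewrite -ltcR -eE.
  have cr : (fun n => r ^+ n) @ \oo --> (0 : R).
    by apply: cvg_expr; rewrite ger0_norm.
  have [N _ Nr] : \forall n \near \oo, `|0 - r ^+ n| < complex.Re e.
    by have /(_ _ _ _ cr _ re0) := @cvgr_dist_lt _ R^o _ \oo _.
  exists N => n Nn; rewrite eE ltcR.
  have := Nr n.+1 (leqW Nn); rewrite /= sub0r normrN ger0_norm //.
  exact: exprn_ge0.
have [z zP] : exists z, forall e, 0 < e -> exists N, forall n,
    (N <= n)%N -> cnorm (sqrt_iter n - z) < e.
  apply: cnorm_complete => e e0; have [N Nr] := small e e0.
  exists N => m n Nm Nn; have [mn|/ltnW nm] := leqP m n.
    rewrite cdistC -(subnKC mn); exact: le_lt_trans (sqrt_iter_cauchy _ _) (Nr _ _).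
  rewrite -(subnKC nm); exact: le_lt_trans (sqrt_iter_cauchy _ _) (Nr _ _).
have zs : star z = z.
  apply/eqP; rewrite -subr_eq0; apply/eqP/cnorm_eq_small => e e0.
  have [N Nz] := zP (e / 2) (divr_gt0 e0 (ltr0n _ 2)).
  have := ltW (Nz _ (leqnn N)); set w := sqrt_iter N => wz.
  rewrite -(subrK w (star z)) -addrA.
  apply: le_trans (cnormD _ _) _; rewrite [e]splitr lerD //.
  have ws : star w = w by exact: sqrt_iter_star.
  rewrite -{1}ws -starN -starD; apply: le_trans (star_contract _) _.
  by rewrite cdistC.
have zE : z = 2^-1 *: (y + z * z).
  apply/eqP; rewrite -subr_eq0; apply/eqP/cnorm_eq_small => e e0.
  pose K := 1 + (r%:C%C + cnorm z).
  have K0 : 0 < K by rewrite ltr_pwDl // addr_ge0 ?cnorm_ge0.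
  have [N Nz] := zP (e / K) (divr_gt0 e0 K0).
  have zN := ltW (Nz _ (leqnn N)); have := ltW (Nz _ (leqnSn N)).
  set w := sqrt_iter N in zN * => zN1.
  have w1 : sqrt_iter N.+1 = 2^-1 *: (y + w * w) by [].
  rewrite -{1}(subrK (sqrt_iter N.+1) z) -addrA.
  apply: le_trans (cnormD _ _) _.
  have -> : e = e / K + (r%:C%C + cnorm z) * (e / K).
    by rewrite -{1}[e / K]mul1r -mulrDl mulrC divfK // gt_eqF.
  apply: lerD; first by rewrite cdistC.
  rewrite w1 -scalerBr cnormZ ger0_norm // opprD addrACA subrr add0r.
  apply: (@le_trans _ _ (cnorm (w * w - z * z))).
    by rewrite ler_piMl ?cnorm_ge0 // invf_le1 // ler1n.
  apply: le_trans (sqrB_le _ _) _.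
  by rewrite ler_pM ?addr_ge0 ?cnorm_ge0 // lerD // sqrt_iter_le.
exists (1 - z); rewrite starD starN star1 zs; split=> //.
have zz : z + z = y + z * z.
  rewrite -[z in LHS]scale1r -scalerDl {1}zE scalerA.
  by rewrite -[1 + 1]/(2%:R) mulfV ?scale1r // pnatr_eq0.
have yE : y = z + z - z * z by rewrite zz addrK.
by rewrite yE mulrBr mulr1 mulrBl mul1r -addrA -opprD addrA.
Qed.

End SquareRoot.
End CstarNorm.

Section StarHom.
Variables (R : realType) (A : cstarType R) (H : hilbertType R).
Variables (rho : A -> H -> H) (hrho : star_hom rho).
Implicit Types (x y : A) (v w : H).

Let rhoL := star_hom_linear hrho.
Let rhoM := star_homM hrho.
Let rho_star := star_hom_star hrho.

Lemma star_hom0 v : rho 0 v = 0.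
Proof. by rewrite -(subrr 1) addrC -scaleN1r rhoL scaleN1r addNr. Qed.

Lemma star_homB x y v : rho (x - y) v = rho x v - rho y v.
Proof. by rewrite addrC -scaleN1r rhoL scaleN1r addrC. Qed.

Lemma star_homZ c x v : rho (c *: x) v = c *: rho x v.
Proof. by rewrite -[c *: x]addr0 rhoL star_hom0 addr0. Qed.

(** With 1 - x^* x = b^2 and b self-adjoint, the difference |v|^2 - |rho(x) v|^2 is
   |rho(b) v|^2. *)
Lemma star_hom_contraction x v : cnorm x < 1 -> `|rho x v| <= `|v|.
Proof.
move=> x1; pose r := complex.Re (cnorm x ^+ 2).
have rE : r%:C%C = cnorm x ^+ 2 by rewrite RRe_real // ger0_real // exprn_ge0 ?cnorm_ge0.
have [||||b [bs bb]] := @selfadjoint_sqrt _ A (star x * x) r.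
- by rewrite -lecR rE exprn_ge0 ?cnorm_ge0.
- by rewrite -ltcR rE exprn_ilt1 ?cnorm_ge0.
- by rewrite cnorm_star rE.
- by rewrite starM starK.
rewrite -(ler_pXn2r (n := 2)) ?nnegrE ?normr_ge0 // -!hdot_norm.
rewrite rho_star -[rho (star x) _]/((rho (star x) \o rho x) v) -rhoM.
have -> : star x * x = 1 - b * b by rewrite bb subKr.
rewrite star_homB hdotBr (star_hom1 hrho) rhoM /= -{1}bs -rho_star.
by rewrite lerBlDr lerDl hdot_norm exprn_ge0.
Qed.

Lemma star_hom_le x v (e : R[i]) : cnorm x < e -> `|rho x v| <= e * `|v|.
Proof.
move=> xe; have e0 := le_lt_trans (cnorm_ge0 _) xe.
rewrite -ler_pdivrMl // -[e^-1]ger0_norm ?invr_ge0 ?(ltW e0) //.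
rewrite -normrZ -star_homZ; apply: star_hom_contraction.
by rewrite cnormZ ger0_norm ?invr_ge0 ?(ltW e0) // mulrC ltr_pdivrMr ?mul1r.
Qed.

(** Commutation with rho(x^* ) is part of the set so that it is stable under the star.
   The adjoint T' serves to move T out of the way in the closedness estimate,
   which then only involves the contractivity of rho. *)
Lemma commuting_subalg (T T' : H -> H) : bop T -> is_adjoint T T' ->
  cstar_subalg [set x | T \o rho x = rho x \o T /\
                        T \o rho (star x) = rho (star x) \o T].
Proof.
move=> bT TT'.
have closedT x : (forall e, 0 < e -> exists2 y, T \o rho y = rho y \o T &
    cnorm (x - y) < e) -> T \o rho x = rho x \o T.
  move=> xcl; apply/funext => v /=; apply: hdot_inj => w.
  apply/eqP; rewrite -subr_eq0 -normr_le0; apply/ler_addgt0Pr => e e0.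
  rewrite add0r; pose K := `|v| * `|T' w| + `|T v| * `|w| + 1.
  have K0 : 0 < K by rewrite ltr_pwDr // addr_ge0 // mulr_ge0.
  have [y yT xy] := xcl (e / K) (divr_gt0 e0 K0).
  have -> : hdot (T (rho x v)) w - hdot (rho x (T v)) w =
      hdot (rho (x - y) v) (T' w) - hdot (rho (x - y) (T v)) w.
    rewrite !star_homB !hdotBl -!TT' -[rho y (T v)]/((rho y \o T) v) -yT /=.
    by rewrite opprB addrA subrK.
  apply: le_trans (ler_normB _ _) _.
  apply: (@le_trans _ _ (e / K * (`|v| * `|T' w| + `|T v| * `|w|))).
    rewrite mulrDr !mulrA lerD //.
      by apply: le_trans (hdot_CS _ _) _; rewrite ler_wpM2r // star_hom_le.
    by apply: le_trans (hdot_CS _ _) _; rewrite ler_wpM2r // star_hom_le.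
  by rewrite mulrAC ler_pdivrMr // ler_wpM2l ?(ltW e0) // lerDl.
have linT c x y : T \o rho x = rho x \o T -> T \o rho y = rho y \o T ->
    T \o rho (c *: x + y) = rho (c *: x + y) \o T.
  move=> Tx Ty; apply/funext => v /=; rewrite !rhoL (bopD _ _ bT) (bopZ _ _ bT).
  by have /= -> := congr1 (@^~ v) Tx; have /= -> := congr1 (@^~ v) Ty.
have mulT x y : T \o rho x = rho x \o T -> T \o rho y = rho y \o T ->
    T \o rho (x * y) = rho (x * y) \o T.
  by move=> Tx Ty; rewrite !rhoM compA Tx -compA Ty.
split=> /=.
- by rewrite star1 (star_hom1 hrho).
- by move=> c x y [Tx Tx'] [Ty Ty']; rewrite starD starZ; split; exact: linT.
- by move=> x y [Tx Tx'] [Ty Ty']; rewrite starM; split; exact: mulT.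
- by move=> x [Tx Tx']; rewrite starK.
move=> x xcl; split; apply: closedT => e e0; have [y [yT yT'] xy] := xcl e e0.
  by exists y.
exists (star y) => //; apply: le_lt_trans xy.
by rewrite -starN -starD star_contract.
Qed.

Lemma commute_generated q a (T T' : H -> H) : universal_qalg q a ->
  bop T -> is_adjoint T T' -> T \o rho a = rho a \o T ->
  T \o rho (star a) = rho (star a) \o T -> forall x, T \o rho x = rho x \o T.
Proof.
move=> [_ gen _] bT TT' Ta Ta' x.
have /(congr1 (@^~ x)) := gen _ (commuting_subalg bT TT') (conj Ta Ta').
by rewrite /= => /propeqP[_ /(_ I)[]].
Qed.

End StarHom.

(** * The tail algebra and the separating operators *)

Section Tail.
Variables (R : realType) (q : R) (G : qFock q (l2Z R)).
Variables (A : cstarType R) (iota : int -> A -> G -> G).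
Hypothesis hiota : forall j, star_hom (iota j).

(** Under these hypotheses W lies in the commutant of each of the von Neumann
   algebras whose union generates, in the definition of the tail algebra, the
   member indexed by I. *)
Lemma tail_comm (I : set int) (T W : G -> G) : finite_set I ->
  tail_algebra iota T -> bop W ->
  (forall k, ~ I k -> forall x, W \o iota k x = iota k x \o W) ->
  T \o W = W \o T.
Proof.
move=> fI tT bW Wiota; have [_] := tT I fI; apply; split=> // V [K [_ KI]].
move=> [_ vV]; apply/esym/vV; split=> // {vV}V.
have KnI k : K k -> ~ I k.
  by move=> Kk Ik; have : (K `&` I) k by []; rewrite KI.
case=> [[k /KnI/Wiota Wk [x _ <-]]|[_ [k /KnI/Wiota Wk [x _ <-]] adjV]].
  exact: Wk.
by rewrite -(adjoint_uniq (star_hom_star (hiota k) x) adjV).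
Qed.

Lemma tail_bop (T : G -> G) : tail_algebra iota T -> bop T.
Proof. by move=> tT; have [] := tT set0 (finite_set0 _). Qed.

End Tail.

Section Vacuum.
Variables (R : realType) (q : R) (G : qFock q (l2Z R)).
Local Notation t := (fock_tensor G).
Local Notation e := (l2e R).

Lemma hdot_vacuum : hdot (vacuum G) (vacuum G) = 1.
Proof.
rewrite fock_dot (qformE q (n := 0)) // (big_pred1 1%g) => [|p].
  by rewrite big_ord0 mulr1 inversionsE big_ord0.
by apply/esym/eqP/permP => -[].
Qed.

Lemma hdot_tensor1 i j : hdot (t [:: e i]) (t [:: e j]) = (i == j)%:R.
Proof.
rewrite fock_dot qform_consr big_ord1 expr0 mul1r /= l2e_orthonormal.
by rewrite -[qform _ _ _](fock_dot G) hdot_vacuum mulr1.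
Qed.

(** U^* commutes with L k because the adjoint relation, U L' k = L' k U, holds on the
   tensors of basis vectors, which are total. *)
Lemma index_unitary_comm (s : int -> int) (U : G -> G) (L L' : int -> G -> G) k :
  -1 < q < 1 -> (forall j, annihilator (e j) (L j)) ->
  (forall j, is_adjoint (L j) (L' j)) ->
  index_unitary s U -> s k = k ->
  U \o L k = L k \o U /\ U \o L' k = L' k \o U.
Proof.
move=> hq aL LL' [uU _ UE] sk.
have [UK KU] := unitary_adj uU.
have bL : bop (L k) by case: (aL k).
have UU := unitary_is_adjoint uU.
have e1 : L k \o adj U = adj U \o L k.
  apply/funext => x /=; apply/eqP; rewrite -subr_eq0; apply/eqP.
  apply: (basis_tensors_sep hq aL LL') => w.
  rewrite hdotBr -!(adjoint_sym (LL' k)) -!UU -(adjoint_sym (LL' k)).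
  rewrite !(UE, creator_tensor (aL k) (LL' k)) -[_ :: _]/([seq e i | i <- k :: w]).
  by rewrite UE /= sk subrr.
have e2 : U \o L k = L k \o U.
  apply/funext => x; apply: (can_inj KU) => /=; rewrite UK.
  by have /= <- := congr1 (@^~ (U x)) e1; rewrite UK.
split=> //; apply: (adjoint_comm UU (adjoint_sym (LL' k))).
exact: esym e1.
Qed.

End Vacuum.

Theorem mainTheorem6 (R : realType) (q : R) (hq : -1 < q < 1)
    (G : qFock q (l2Z R))
    (l : int -> G -> G) (hl : forall j, annihilator (l2e R j) (l j))
    (A : cstarType R) (a : A) (hA : universal_qalg q a)
    (iota : int -> A -> G -> G)
    (hiota : forall j, star_hom (iota j) /\ iota j a = l j)
    (U : (int -> int) -> G -> G)
    (hU : forall s, finperm s -> index_unitary s (U s))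
    (Utau : G -> G) (hUtau : index_unitary (fun i => i + 1) Utau) :
  [/\ tail_algebra iota <> exchangeable_algebra U,
      exchangeable_algebra U <> stationary_algebra Utau &
      tail_algebra iota <> stationary_algebra Utau] /\
  [/\ tail_algebra iota `<` exchangeable_algebra U,
      stationary_algebra Utau Utau &
      ~ exchangeable_algebra U Utau].
Proof.
have hi j : star_hom (iota j) by case: (hiota j).
pose l' j := iota j (star a).
have ll' j : is_adjoint (l j) (l' j).
  by rewrite -(proj2 (hiota j)); exact: star_hom_star.
have bl j : bop (l j) by case: (hl j).
have bl' j : bop (l' j) by exact: star_hom_bop.
have gen k T T' : bop T -> is_adjoint T T' -> T \o l k = l k \o T ->
    T \o l' k = l' k \o T -> forall x, T \o iota k x = iota k x \o T.
  by rewrite -(proj2 (hiota k)) => *; exact: (commute_generated (hi k) hA) _ _ _.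
have tail_exch : tail_algebra iota `<=` exchangeable_algebra U.
  move=> T tT; split=> [|s fs]; first exact: tail_bop tT.
  have uU := hU s fs; have [us _ _] := uU.
  apply/(conj_fixedE _ us); split; first exact: tail_bop tT.
  apply/esym/(tail_comm hi (proj2 fs) tT); first exact: unitary_bop.
  move=> k /= /contrapT sk.
  have [c c'] := index_unitary_comm hq hl ll' uU sk.
  apply: (gen k _ (adj (U s))) => //; first exact: unitary_bop.
  exact: unitary_is_adjoint.
have vac_exch : exchangeable_algebra U (rank_one (vacuum G) (vacuum G)).
  split=> [|s fs]; first exact: rank_one_bop.
  have [us Uv _] := hU s fs; have [_ _ iU] := us.
  apply/(conj_fixedE _ us); split; first exact: rank_one_bop.
  apply/funext => x; rewrite /= /rank_one (bopZ _ _ (unitary_bop us)) Uv.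
  by rewrite -{3}Uv iU.
have vac_tail : ~ tail_algebra iota (rank_one (vacuum G) (vacuum G)).
  have [J [bJ JE]] := reversal_exists G.
  have JJ := reversal_selfadjoint bJ JE.
  pose r := J \o l 0 \o J.
  have br : bop r by do 2! [apply: bop_comp => //].
  move=> tP; have : rank_one (vacuum G) (vacuum G) \o r =
                    r \o rank_one (vacuum G) (vacuum G).
    apply: (tail_comm hi (finite_set1 0) tP br) => k k0.
    have ek : hdot (l2e R k) (l2e R 0) = 0.
      by rewrite l2e_orthonormal; case: eqP.
    have [c c'] := reversed_annihilator_comm (hl 0) (ll' 0) (bl' 0)
                     (hl k) (ll' k) (bl' k) ek bJ JE.
    apply: (gen k r (J \o l' 0 \o J)) => //.
    by move=> x y; rewrite /r /= JJ ll' JJ.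
  move=> /(congr1 (@^~ (fock_tensor G [:: l2e R 0]))) /=.
  have -> : r (fock_tensor G [:: l2e R 0]) = vacuum G.
    rewrite /r /= JE (proj2 (hl 0)) big_ord1 expr0 mul1r /= l2e_orthonormal.
    by rewrite scale1r JE.
  rewrite /rank_one hdot_vacuum scale1r.
  rewrite fock_dot qform_size // scale0r (bop0 br) => v0.
  by have := hdot_vacuum G; rewrite v0 linear0l => /esym/eqP; rewrite oner_eq0.
have [utau _ tauE] := hUtau.
have tau_stat : stationary_algebra Utau Utau.
  by apply/(conj_fixedE _ utau); split=> //; exact: unitary_bop.
have tau_exch : ~ exchangeable_algebra U Utau.
  (* The transposition of 0 and 1; the two orders of composition send t(e_0) to
     t(e_0) and to t(e_2). *)
  pose s (i : int) : int := if i == 0 then 1 else if i == 1 then 0 else i.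
  have sK : involutive s.
    move=> i; rewrite /s; have [->//|i0] := eqVneq i 0.
    by have [->//|i1] := eqVneq i 1; rewrite (negPf i0) (negPf i1).
  have fs : finperm s.
    split; first by exists s.
    apply: (@sub_finite_set _ _ [set 0; 1]); last exact: finite_set2.
    move=> i /=; rewrite /s; have [->|i0] := eqVneq i 0; first by left.
    by have [->|//] := eqVneq i 1; right.
  move=> [_ /(_ s fs)]; have [us _ sE] := hU s fs.
  move=> /(conj_fixedE _ us)[_ /(congr1 (@^~ (fock_tensor G [:: l2e R 0]))) /=].
  rewrite (tauE [:: 0]) (sE [:: 0]) (sE [:: 1]) (tauE [:: 1]) /s /= => e02.
  have := hdot_tensor1 G 0 0; rewrite eqxx {1}e02 hdot_tensor1 => /esym/eqP.
  by rewrite oner_eq0.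
have te : tail_algebra iota <> exchangeable_algebra U.
  by move=> te; apply: vac_tail; rewrite te.
split; split=> //.
- by move=> es; apply: tau_exch; rewrite es.
- by move=> ts; apply/tau_exch/tail_exch; rewrite ts.
by rewrite properEneq; split=> //; apply/eqP.
Qed.
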